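(* Let $X$ be an $L$-dimensional zero-mean Gaussian random vector with covariance $\Sigma_X=\Theta^T\Lambda_X\Theta\succ0$, where $\Theta$ is unitary and $\Lambda_X=\mathrm{diag}(\lambda_1,\ldots,\lambda_L)$ with $\lambda_\ell>0$. With the KL divergence $D(P_{\hat X}\|P_X)$ as the perception metric, the rate-distortion-perception function $R(D,P)$ is given by $$R(D,P)=\min_{\{\hat\lambda_\ell,\gamma_\ell\}_{\ell=1}^L}\ \frac12\sum_{\ell=1}^L\log\frac{\lambda_\ell}{\gamma_\ell}$$ subject to $0<\gamma_\ell\le\lambda_\ell$ and $0\le\hat\lambda_\ell$ for all $\ell$, $\sum_{\ell=1}^L D_\ell(\gamma_\ell,\hat\lambda_\ell)\le D$, and $\sum_{\ell=1}^L P_\ell(\hat\lambda_\ell)\le P$, where $$D_\ell(\gamma_\ell,\hat\lambda_\ell)=\lambda_\ell-2\sqrt{\hat\lambda_\ell(\lambda_\ell-\gamma_\ell)}+\hat\lambda_\ell,\qquad P_\ell(\hat\lambda_\ell)=\frac12\Big(\frac{\hat\lambda_\ell}{\lambda_\ell}-1+\log\frac{\lambda_\ell}{\hat\lambda_\ell}\Big).$$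
   Context: The (information) rate-distortion-perception function is $R(D,P)=\inf I(X;\hat X)$ over conditional distributions $P_{\hat X|X}$, $\hat X\in\mathbb{R}^L$, such that $\mathbb{E}[\|X-\hat X\|^2]\le D$ and $D(P_{\hat X}\|P_X)\le P$, where $D(P_{\hat X}\|P_X)=\int P_{\hat X}(x)\log\frac{P_{\hat X}(x)}{P_X(x)}dx$. Logarithms are natural. *)

(* Defs.v *)
From HB Require Import structures.
From mathcomp Require Import all_boot all_order all_algebra.
From mathcomp Require Import all_classical all_reals all_analysis.
Set Implicit Arguments. Unset Strict Implicit. Unset Printing Implicit Defensive.
Import Order.TTheory GRing.Theory Num.Theory.
Local Open Scope classical_set_scope.
Local Open Scope ring_scope.

(* The vector space R^L is modelled by L.-tuple R, with the canonical
   (product / Borel) sigma-algebra generated by the coordinate projections. *)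

Section defs.
Context {R : realType}.

Definition is_density d (T : measurableType d) (P Q : set T -> \bar R)
  (f : T -> R) : Prop :=
  measurable_fun [set: T] f /\ (forall x, 0 <= f x) /\
  forall A, measurable A -> P A = (\int[Q]_(x in A) (f x)%:E)%E.

(* Kullback-Leibler divergence D(P||Q) = \int (dP/dQ) log (dP/dQ) dQ
   (= \int p log (p/q) when P, Q have densities p, q), and +oo when
   P is not absolutely continuous w.r.t. Q (no density exists).
   Convention 0 log 0 = 0 (ln 0 = 0 in mathcomp). The value does not depend
   on the chosen version of the density (they agree Q-a.e.). *)
Definition KL d (T : measurableType d) (P Q : set T -> \bar R) : \bar R :=
  match pselect (exists f, is_density P Q f) with
  | left h => let f := projT1 (cid h) in
              (\int[Q]_x ((f x)%:E * (ln (f x))%:E))%E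
  | right _ => +oo%E
  end.

Definition marg1 d1 d2 (T1 : measurableType d1) (T2 : measurableType d2)
  (pi : set (T1 * T2) -> \bar R) : set T1 -> \bar R := pushforward pi fst.
Definition marg2 d1 d2 (T1 : measurableType d1) (T2 : measurableType d2)
  (pi : set (T1 * T2) -> \bar R) : set T2 -> \bar R := pushforward pi snd.

Definition mutual_info d1 d2 (T1 : measurableType d1) (T2 : measurableType d2)
  (pi : set (T1 * T2) -> \bar R) : \bar R :=
  KL pi (marg1 pi \x marg2 pi)%E.

Definition sqnorm (L : nat) (x : L.-tuple R) : R := \sum_(i < L) (tnth x i) ^+ 2.

Definition dotv (L : nat) (a : 'I_L -> R) (x : L.-tuple R) : R :=
  \sum_(i < L) a i * tnth x i.

Definition gaussian_law (L : nat) (S : 'M[R]_L)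
  (mu : probability (L.-tuple R) R) : Prop :=
  forall a : 'I_L -> R, (exists i, a i != 0) ->
    pushforward mu (dotv a) =
    normal_prob 0 (Num.sqrt (\sum_(i < L) \sum_(j < L) a i * S i j * a j)).

(* Information rate-distortion-perception function of the source law muX
   (KL perception): inf I(X;Xhat) over joint laws pi of (X,Xhat) whose first
   marginal is P_X (equivalently over conditional laws P_{Xhat|X}) with
   E||X - Xhat||^2 <= D and D(P_Xhat || P_X) <= P. *)
Definition RDP (L : nat) (muX : probability (L.-tuple R) R) (D P : R) : \bar R :=
  ereal_inf [set mutual_info pi | pi in
    [set pi : probability (L.-tuple R * L.-tuple R)%type R |
       marg1 pi = muX /\
       (\int[pi]_z (sqnorm [tuple tnth z.1 i - tnth z.2 i | i < L])%:E <= D%:E)%E /\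
       (KL (marg2 pi) muX <= P%:E)%E]].

Definition Dl (lam gam lamh : R) : R :=
  lam - 2 * Num.sqrt (lamh * (lam - gam)) + lamh.
Definition Pl (lam lamh : R) : \bar R :=
  if lamh == 0 then +oo%E else ((lamh / lam - 1 + ln (lam / lamh)) / 2)%:E.

Definition feasible (L : nat) (lam : 'I_L -> R) (D P : R)
  (lamh gam : 'I_L -> R) : Prop :=
  (forall l, 0 < gam l <= lam l) /\ (forall l, 0 <= lamh l) /\
  \sum_(l < L) Dl (lam l) (gam l) (lamh l) <= D /\
  (\sum_(l < L) Pl (lam l) (lamh l) <= P%:E)%E.

Definition objective (L : nat) (lam gam : 'I_L -> R) : R :=
  (\sum_(l < L) ln (lam l / gam l)) / 2.

End defs.

(* Main.v *)
(** The coordinates [Y = Theta X] are shown to be independent [N(0, lam l)]: their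
linear combinations are normal, and a finite measure on the line is determined by
its integrals of [cos (b + t x)], because polynomials in such functions converge
boundedly to indicators of half-lines.

Lower bound: for a joint law, let [lamh l] be the energy of the coordinate [Yh l] of
the reconstruction and [gam l] the error of the best linear prediction of [Y l] from
[Yh l]. The Donsker-Varadhan inequality, with the Gaussian log-likelihood ratios of
these parameters as test functions, bounds the mutual information below by the
objective and the divergence below by the sum of the [P_l].

Upper bound: the backward channel [Y l = a Yh l + N(0, gam l)], with [Yh l] drawn from
[N(0, lamh l)], meets both constraints and has the objective as mutual information.
Since the [P_l] are coercive, the minimum is attained by compactness. *)

Require Import Defs.
From HB Require Import structures.
From mathcomp Require Import all_boot all_order all_algebra.
From mathcomp Require Import all_classical all_reals all_analysis.
From mathcomp Require Import measurable_realfun ring lra.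
Import Order.TTheory GRing.Theory Num.Theory.
Import numFieldNormedType.Exports.
Local Open Scope classical_set_scope.
Local Open Scope ring_scope.

Set Implicit Arguments. Unset Strict Implicit. Unset Printing Implicit Defensive.

(** Variational bounds spare any computation with conditional laws or entropies of the
    reconstruction. A quadratic test function has an integral fixed by second moments, which a joint
    law of finite distortion possesses, and the exponential of a log-likelihood ratio integrates to
    1 because the coordinates are independent under the source law. Degenerate parameters
    ([lamh l = 0] or [gam l = 0]) are excluded by a test law of very small variance: the bound would
    exceed [P], respectively the mutual information.

    The Gaussian hypothesis concerns one-dimensional projections only, so independence has to be
    derived: coordinates are split off one at a time, and each step concerns a pair of real
    functions under a weighted measure. Cosines with arbitrary phase stand for complex exponentials;
    [1 + cos] is nonnegative, so it can serve as a density.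

    A probability here is a function on all sets, and the constraint on the first marginal is an
    equality of such functions; the achieving law therefore has to be adjusted on non-measurable
    sets. *)

Section density.
Context d (T : measurableType d) (R : realType).
Local Open Scope ereal_scope.
Import HBNNSimple.

(** * Densities, divergence and the Donsker-Varadhan inequality *)

Lemma is_density_ge0_integral (P Q : {measure set T -> \bar R}) (f : T -> R)
    (F : T -> \bar R) :
  is_density P Q f -> measurable_fun setT F -> (forall x, 0 <= F x) ->
  \int[P]_x F x = \int[Q]_x (F x * (f x)%:E).
Proof.
move=> [mf [f0 PE]] mF F0.
pose h := nnsfun_approx measurableT mF.
have -> : \int[P]_x F x = lim (\int[P]_x (EFin \o h n) x @[n --> \oo]).
  under eq_integral => x _.
    rewrite (_ : F x = lim ((EFin \o h n) x @[n --> \oo])); last first.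
      by apply/esym/cvg_lim => //; exact: cvg_nnsfun_approx.
    over.
  apply: monotone_convergence => //.
  - by move=> n; exact/measurable_EFinP.
  - by move=> n x _; rewrite lee_fin.
  - by move=> x _ a b ab; rewrite lee_fin; exact/lefP/nd_nnsfun_approx.
have -> : \int[Q]_x (F x * (f x)%:E) =
    lim (\int[Q]_x ((EFin \o h n) x * (f x)%:E) @[n --> \oo]).
  under eq_integral => x _.
    rewrite (_ : F x * _ = lim (((EFin \o h n) x * (f x)%:E) @[n --> \oo])); last first.
      by apply/esym/cvg_lim => //; apply: cvgeZr => //; exact: cvg_nnsfun_approx.
    over.
  apply: monotone_convergence => //.
  - by move=> n; apply/emeasurable_funM; exact/measurable_EFinP.
  - by move=> n x _; rewrite mule_ge0 ?lee_fin.
  - move=> x _ a b ab; rewrite lee_wpmul2r ?lee_fin//.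
    exact/lefP/nd_nnsfun_approx.
suff suf n : \int[Q]_x ((EFin \o h n) x * (f x)%:E) = \int[P]_x (EFin \o h n) x.
  by under [in RHS]eq_fun do rewrite suf.
transitivity (\int[P]_x
   (\sum_(y \in range (h n)) (y * \1_(h n @^-1` [set y]) x)%:E)); last first.
  by apply: eq_integral => t tE; rewrite /= fimfunE -fsumEFin.
have mind r : measurable_fun setT (fun x => (r * \1_(h n @^-1` [set r]) x)%:E).
  by apply/measurable_EFinP; exact: measurable_funM.
rewrite ge0_integral_fsum//; last by move=> m y Ey; exact: nnfun_muleindic_ge0.
transitivity (\int[Q]_x (\sum_(y \in range (h n))
    (y * \1_(h n @^-1` [set y]) x)%:E * (f x)%:E)).
  under [RHS]eq_integral => x xE.
    rewrite -ge0_mule_fsuml => [|y]; last exact: nnfun_muleindic_ge0.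
    rewrite fsumEFin // -(fimfunE _ x); over.
  by [].
rewrite ge0_integral_fsum//; last 2 first.
  - by move=> y; apply: emeasurable_funM => //; exact/measurable_EFinP.
  - by move=> m y Ey; rewrite mule_ge0 ?lee_fin// -lee_fin nnfun_muleindic_ge0.
apply: eq_fsbigr => r rhn.
under [RHS]eq_integral do rewrite EFinM.
rewrite integralZl_indic_nnsfun => //.
under eq_integral do rewrite EFinM -muleA.
rewrite ge0_integralZl//.
- under eq_integral do rewrite muleC.
  rewrite (eq_integral ((EFin \o f) \_ (h n @^-1` [set r]))); last first.
    by move=> x xE; rewrite epatch_indic.
  by rewrite -integral_mkcond -PE// integral_indic// setIT.
- by apply: emeasurable_funM; exact/measurable_EFinP.
- by move=> t Et; rewrite mule_ge0 ?lee_fin.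
- by move: rhn; rewrite inE => -[t _ <-]; rewrite lee_fin.
Qed.

Lemma is_density_integrable (P Q : {measure set T -> \bar R}) (f : T -> R)
    (F : T -> \bar R) :
  is_density P Q f -> P.-integrable setT F ->
  Q.-integrable setT (fun x => F x * (f x)%:E) /\
  \int[P]_x F x = \int[Q]_x (F x * (f x)%:E).
Proof.
move=> df iF; have [mf [f0 PE]] := df; have mF := measurable_int _ iF.
have E1 : (fun x => F x * (f x)%:E)^\+ = (fun x => F^\+ x * (f x)%:E).
  by apply/funext => x; rewrite !funeposE !(muleC _ (f x)%:E) maxe_pMr ?lee_fin// mule0.
have E2 : (fun x => F x * (f x)%:E)^\- = (fun x => F^\- x * (f x)%:E).
  by apply/funext => x; rewrite !funenegE !(muleC _ (f x)%:E) -muleN maxe_pMr ?lee_fin// mule0.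
split; last first.
  rewrite integralE [RHS]integralE E1 E2.
  rewrite -!(is_density_ge0_integral df)//.
    exact: measurable_funeneg.
  exact: measurable_funepos.
apply/integrableP; split.
  by apply: emeasurable_funM => //; exact/measurable_EFinP.
case/integrableP : iF => _; rewrite (is_density_ge0_integral df)//; last first.
  exact: measurableT_comp.
apply: le_lt_trans; apply: ge0_le_integral => //.
- apply: measurableT_comp => //; apply: emeasurable_funM => //.
  exact/measurable_EFinP.
- by apply: emeasurable_funM; [exact: measurableT_comp|exact/measurable_EFinP].
- by move=> x _; rewrite abseM [X in _ * X]gee0_abs// lee_fin.
Qed.

(** [KL] integrates a density obtained by choice. Since [P] is finite, densities are [Q]-integrable,
    and two of them with equal integrals on all measurable sets agree almost everywhere. *)
Lemma KL_density (P : probability T R) (Q : {measure set T -> \bar R})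
    (g : T -> R) :
  is_density P Q g -> KL P Q = \int[Q]_x ((g x)%:E * (ln (g x))%:E).
Proof.
move=> dg; rewrite /KL; case: pselect => [h|]; last first.
  by move=> h; exfalso; apply: h; exists g.
case: cid => f df /=.
have [[mf [f0 fE]] [mg [g0 gE]]] := (df, dg).
have : ae_eq Q setT (EFin \o f) (EFin \o g).
  apply: integral_ae_eq => //.
  - apply/integrableP; split; first exact/measurable_EFinP.
    under eq_integral do rewrite /= ger0_norm//.
    by rewrite -fE// probability_setT ltry.
  - exact/measurable_EFinP.
  - by move=> E _ mE; rewrite -fE// -gE.
have mfl (k : T -> R) : measurable_fun setT k ->
    measurable_fun setT (fun x => (k x)%:E * (ln (k x))%:E).
  move=> mk; apply: emeasurable_funM; apply/measurable_EFinP => //.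
  by apply: measurableT_comp => //; exact: measurable_ln.
move=> fg; apply: ae_eq_integral => //; try exact: mfl.
apply: filterS fg => x /= + _ => /(_ Logic.I)[->]//.
Qed.

Lemma KL_integral_ln (P : probability T R) (Q : {measure set T -> \bar R})
    (g : T -> R) :
  is_density P Q g -> P.-integrable setT (fun x => (ln (g x))%:E) ->
  KL P Q = \int[P]_x (ln (g x))%:E.
Proof.
move=> dg /(is_density_integrable dg)[_ ->]; rewrite (KL_density dg).
by apply: eq_integral => x _; rewrite muleC.
Qed.

(* Pointwise, [f ln f >= f t + f - exp t]: it is [ln u <= u - 1] at
   [u = exp t / f]. *)
Lemma donsker_varadhan (P Q : probability T R) (t : T -> R) :
  P.-integrable setT (EFin \o t) -> \int[Q]_x (expR (t x))%:E <= 1 ->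
  \int[P]_x (t x)%:E <= KL P Q.
Proof.
move=> it et1; rewrite /KL; case: pselect => [h|_]; last exact: leey.
case: cid => f df /=; have [mf [f0 fE]] := df.
have mt : measurable_fun setT t by apply/measurable_EFinP; exact: measurable_int it.
have [itf ->] := is_density_integrable df it.
have ifQ : Q.-integrable setT (EFin \o f).
  apply/integrableP; split; first exact/measurable_EFinP.
  under eq_integral do rewrite /= ger0_norm//.
  by rewrite -fE// probability_setT ltry.
have ie : Q.-integrable setT (fun x => (expR (t x))%:E).
  apply/integrableP; split.
    by apply/measurable_EFinP; apply: measurableT_comp.
  under eq_integral do rewrite /= ger0_norm ?expR_ge0//.
  exact: le_lt_trans et1 (ltry _).
(* The added terms [f - expR t] integrate to [1 - \int expR t], which is nonnegative, so they only
   increase the integral. *)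
pose A := fun x => (t x)%:E * (f x)%:E + ((f x)%:E - (expR (t x))%:E).
have iA : Q.-integrable setT A by apply: integrableD => //; exact: integrableB.
have AE : \int[Q]_x ((t x)%:E * (f x)%:E) <= \int[Q]_x A x.
  rewrite /A integralD//; last exact: integrableB.
  rewrite integralB//.
  rewrite -[\int[Q]_x (EFin \o f) x]fE// probability_setT.
  by rewrite leeDl// sube_ge0// orbT.
apply: (le_trans AE).
have mG : measurable_fun setT (fun x => (f x)%:E * (ln (f x))%:E).
  apply: emeasurable_funM; apply/measurable_EFinP => //.
  by apply: measurableT_comp => //; exact: measurable_ln.
have AG x : A x <= (f x)%:E * (ln (f x))%:E.
  rewrite /A -!EFinM -EFinB -EFinD lee_fin.
  (* Where [f] vanishes, the right side is [0] whatever the value of [ln 0], and the left side is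
     [- expR t]. *)
  have [fx0|fx0] := eqVneq (f x) 0%R.
    by rewrite fx0 mulr0 mul0r add0r sub0r oppr_le0 expR_ge0.
  have fpos : (0 < f x)%R by rewrite lt0r fx0 f0.
  have e0 : (0 < expR (t x) / f x)%R by rewrite divr_gt0 ?expR_gt0.
  have := @le_ln1Dx _ (expR (t x) / f x - 1).
  rewrite (_ : (1 + (expR (t x) / f x - 1) = expR (t x) / f x)%R); last by ring.
  rewrite (_ : (-1 < expR (t x) / f x - 1)%R); last by lra.
  move=> /(_ isT).
  rewrite ln_div ?posrE ?expR_gt0// expRK => H.
  have : (f x * (t x - ln (f x)) <= f x * (expR (t x) / f x - 1))%R.
    by rewrite ler_pM2l.
  rewrite mulrBr [X in (_ <= X)%R -> _]mulrBr mulrCA divff// !mulr1 => H2.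
  by rewrite [(t x * f x)%R]mulrC; lra.
(* [f ln f] need not be integrable, so positive and negative parts are compared separately. *)
rewrite integralE [leRHS]integralE leeB//.
- apply: ge0_le_integral => //.
  + by apply: measurable_funepos; exact: measurable_int iA.
  + exact: measurable_funepos.
  + by move=> x _; rewrite !funeposE ge_max !le_max AG/= lexx orbT.
- apply: ge0_le_integral => //.
  + exact: measurable_funeneg.
  + by apply: measurable_funeneg; exact: measurable_int iA.
  + by move=> x _; rewrite !funenegE ge_max !le_max lexx orbT andbT leeN2 AG.
Qed.

End density.

(** * Finite measures on the line are determined by their cosine integrals *)

Section bernoulli.
Context {R : realFieldType}.
Implicit Types (u : R) (n : nat).

Lemma bernoulli_ge u n : 0 <= u <= 1 -> 1 - n%:R * u <= (1 - u) ^+ n.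
Proof.
move=> /andP[u0 u1]; elim: n => [|n ih]; first by rewrite mul0r subr0 expr0.
rewrite exprS; apply: (@le_trans _ _ ((1 - u) * (1 - n%:R * u))).
  have := mulr_ge0 (ler0n R n) (mulr_ge0 u0 u0); rewrite -natr1; nra.
by rewrite ler_wpM2l// subr_ge0.
Qed.

(** The induction step is [(1 - u) (1 + (n + 1) u) <= 1 + n u]. This bounds the power above by
    [1 / (1 + n u)]. *)
Lemma bernoulli_le u n : 0 <= u <= 1 -> (1 - u) ^+ n * (1 + n%:R * u) <= 1.
Proof.
move=> /andP[u0 u1]; elim: n => [|n ih]; first by rewrite mul0r addr0 expr0 mul1r.
apply: le_trans ih; rewrite exprSr -mulrA ler_wpM2l ?exprn_ge0 ?subr_ge0//.
have := mulr_ge0 (ler0n R n) (mulr_ge0 u0 u0); rewrite -natr1; nra.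
Qed.

End bernoulli.

Lemma integrable_bounded d (T : measurableType d) (R : realType)
    (m : {measure set T -> \bar R}) (f : T -> R) (M : R) : (m setT < +oo)%E ->
  measurable_fun setT f -> (forall x, `|f x| <= M) ->
  m.-integrable setT (EFin \o f).
Proof.
move=> mfin mf fM; apply: measurable_bounded_integrable => //.
exists M; split; first exact: num_real.
by move=> x Mx y _; exact: le_trans (ltW Mx).
Qed.

Section characteristic.
Context {R : realType}.
Local Notation Rm := (measurableTypeR R).

(* [(1 - u) ^ N] is close to [1] or [0] according as [N u] is small or large; here
   [N u = n (2 w) ^ (2 n)], whose factor [n] settles the boundary case [w = 1 / 2]. *)
Lemma cvg_polynomial_step (w : R) : 0 <= w <= 1 ->
  (1 - w ^+ (2 * n)) ^+ (n * 4 ^ n) @[n --> \oo] --> ((w < 1 / 2)%R%:R : R).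
Proof.
move=> /andP[w0 w1].
have u01 n : 0 <= w ^+ (2 * n) <= 1 by rewrite exprn_ge0//= exprn_ile1.
have uE n : (n * 4 ^ n)%:R * w ^+ (2 * n) = n%:R * ((2 * w) ^+ n * (2 * w) ^+ n) :> R.
  rewrite natrM natrX -mulrA; congr (_ * _).
  by rewrite -exprMn exprM -exprMn; congr (_ ^+ n); rewrite expr2; ring.
have [wlt|wge] := ltP.
- pose del := 1 - 2 * w; have del0 : 0 < del by rewrite /del; lra.
  have r0 : 0 <= 2 * w by lra.
  apply: (@squeeze_cvgr _ _ _ _ (fun n => 1 - (2 * w) ^+ n * del^-1) (cst 1)).
  + apply: nearW => n; apply/andP; split; last first.
      have /andP[? ?] := u01 n.
      by rewrite exprn_ile1// ?subr_ge0// gerBl.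
    apply: le_trans (bernoulli_ge _ (u01 n)); rewrite uE lerD2l lerN2.
    (* Bernoulli for [1 - del = 2 w] gives [n (2 w)^n <= 1 / del], hence [N u <= (2 w)^n / del],
       which tends to [0]. *)
    have /(bernoulli_le n) : 0 <= del <= 1 by rewrite /del; apply/andP; lra.
    rewrite (_ : 1 - del = 2 * w); last by rewrite /del; ring.
    set r := (2 * w) ^+ n => H; have rn0 : 0 <= r by rewrite exprn_ge0.
    rewrite ler_pdivlMr// (_ : _ * del = r * (r * (n%:R * del))); last by ring.
    rewrite -[leRHS]mulr1 ler_wpM2l//; apply: le_trans H.
    by rewrite (mulrDr r 1) mulr1 lerDr.
  + rewrite -[X in _ --> X]subr0; apply: cvgB; first exact: cvg_cst.
    rewrite -(mul0r del^-1); apply: cvgM; last exact: cvg_cst.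
    by apply: cvg_expr; rewrite ger0_norm//; lra.
  + exact: cvg_cst.
- apply: (@squeeze_cvgr _ _ _ _ (cst 0) harmonic); last 2 first.
    exact: cvg_cst.
    exact: cvg_harmonic.
  apply: nearW => n; have /andP[? ?] := u01 n.
  rewrite exprn_ge0 ?subr_ge0//= -[leRHS]mul1r ler_pdivlMr//.
  (* Here [2 w >= 1], so [N u >= n] and the power is at most [1 / (n + 1)]. *)
  apply: le_trans (bernoulli_le (n * 4 ^ n) (u01 n)).
  rewrite ler_wpM2l ?exprn_ge0 ?subr_ge0// uE -natr1 addrC lerD2l.
  rewrite ler_peMr// -exprMn exprn_ege1//.
  by rewrite -[X in X <= _]mulr1 ler_pM//; lra.
Qed.

Variables m1 m2 : {measure set Rm -> \bar R}.
Hypothesis m1fin : (m1 setT < +oo)%E.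
Hypothesis m2fin : (m2 setT < +oo)%E.
Hypothesis m12 : forall b t : R,
  (\int[m1]_x (cos (b + t * x))%:E = \int[m2]_x (cos (b + t * x))%:E)%E.

Let eqint (f : R -> R) := (\int[m1]_x (f x)%:E = \int[m2]_x (f x)%:E)%E.

Let mcos (b t : R) : measurable_fun [set: R] (fun x => cos (b + t * x)).
Proof.
apply: measurableT_comp; first exact: (continuous_measurable_fun (@continuous_cos R)).
by apply: measurable_funD => //; exact: measurable_funM.
Qed.

Let bint (m : {measure set Rm -> \bar R}) (f : R -> R) :
  (m setT < +oo)%E -> measurable_fun [set: R] f -> (exists M, forall x, `|f x| <= M) ->
  m.-integrable setT (EFin \o f).
Proof.
by move=> mfin mf [M fM]; exact: (@integrable_bounded _ _ _ m f M).
Qed.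

(** The arbitrary cosine factor is what makes this class closed under multiplication by cosines;
    equality of the integrals of [f] alone would not pass to products. *)
Let trig (f : R -> R) := [/\ measurable_fun [set: R] f,
  (exists M, forall x, `|f x| <= M) &
  forall b t, eqint (fun x => f x * cos (b + t * x))].

Let eq_trig f g : trig f -> f =1 g -> trig g.
Proof. by move=> tf /funext <-. Qed.

Let trig1 : trig (cst 1).
Proof.
split=> //; first by exists 1 => x; rewrite normr1.
by move=> b t; rewrite /eqint/=; under eq_integral do rewrite mul1r;
  under [RHS]eq_integral do rewrite mul1r.
Qed.

Let trigD f g k : trig f -> trig g -> trig (fun x => f x + k * g x).
Proof.
move=> [mf [M fM] ef] [mg [N gN] eg].
have bf b t : exists M, forall x, `|f x * cos (b + t * x)| <= M.
  exists M => x; rewrite normrM -[M]mulr1 ler_pM//; exact: cos_max.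
have bg b t : exists M, forall x, `|g x * cos (b + t * x)| <= M.
  exists N => x; rewrite normrM -[N]mulr1 ler_pM//; exact: cos_max.
split.
- by apply: measurable_funD => //; exact: measurable_funM.
- exists (M + `|k| * N) => x; rewrite (le_trans (ler_normD _ _))//.
  by rewrite lerD// normrM ler_wpM2l.
- move=> b t; rewrite /eqint.
  have H (m : {measure set Rm -> \bar R}) : (m setT < +oo)%E ->
     (\int[m]_x ((f x + k * g x) * cos (b + t * x))%:E =
      \int[m]_x (f x * cos (b + t * x))%:E +
      k%:E * \int[m]_x (g x * cos (b + t * x))%:E)%E.
    move=> mfin.
    have i1 : m.-integrable setT (EFin \o (fun x => f x * cos (b + t * x))).
      by apply: bint => //; exact: measurable_funM.
    have i2 : m.-integrable setT (EFin \o (fun x => g x * cos (b + t * x))).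
      by apply: bint => //; exact: measurable_funM.
    rewrite -integralZl// -integralD//; last exact: integrableZl.
    by apply: eq_integral => x _; rewrite -EFinM -EFinD mulrDl mulrA.
  by rewrite !H// (ef b t) (eg b t).
Qed.

(** A product of two cosines is half the sum of the cosines of the sum and of the difference of
    their arguments, and both are again of the form [b + t x]. *)
Let trigcos f b t : trig f -> trig (fun x => f x * cos (b + t * x)).
Proof.
move=> [mf [M fM] ef]; split.
- exact: measurable_funM.
- exists M => x; rewrite normrM -[M]mulr1 ler_pM//; exact: cos_max.
- move=> b' t'; rewrite /eqint.
  have H x : f x * cos (b + t * x) * cos (b' + t' * x) =
      (f x * cos ((b + b') + (t + t') * x) + 1 * (f x * cos ((b - b') + (t - t') * x))) / 2.
    rewrite (_ : b + b' + (t + t') * x = (b + t * x) + (b' + t' * x)); last ring.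
    rewrite (_ : b - b' + (t - t') * x = (b + t * x) - (b' + t' * x)); last ring.
    move: (b + t * x) (b' + t' * x) => u v.
    by rewrite cosB cosD; field.
  have H2 (m : {measure set Rm -> \bar R}) : (m setT < +oo)%E ->
     (\int[m]_x (f x * cos (b + t * x) * cos (b' + t' * x))%:E =
      (2^-1)%:E * (\int[m]_x (f x * cos ((b + b') + (t + t') * x))%:E +
       \int[m]_x (f x * cos ((b - b') + (t - t') * x))%:E))%E.
    move=> mfin.
    have i1 u v : m.-integrable setT (EFin \o (fun x => f x * cos (u + v * x))).
      apply: bint => //; first exact: measurable_funM.
      by exists M => x; rewrite normrM -[M]mulr1 ler_pM//; exact: cos_max.
    rewrite -(integralD measurableT (i1 (b + b') (t + t')) (i1 (b - b') (t - t'))).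
    rewrite -integralZl//; last exact: integrableD.
    by apply: eq_integral => x _; rewrite H -EFinD -EFinM mul1r mulrC.
  by rewrite !H2// (ef (b + b') (t + t')) (ef (b - b') (t - t')).
Qed.

Let trig_eqint f : trig f -> eqint f.
Proof.
move=> [mf fM /(_ 0 0)]; rewrite /eqint.
by under eq_integral do rewrite mul0r addr0 cos0 mulr1;
  under [in RHS]eq_integral do rewrite mul0r addr0 cos0 mulr1.
Qed.

Let eqint_lim (f_ : nat -> R -> R) (f : R -> R) :
  (forall n, measurable_fun [set: R] (f_ n)) ->
  (forall n x, `|f_ n x| <= 1) ->
  (forall x, f_ n x @[n --> \oo] --> f x) ->
  (forall n, eqint (f_ n)) -> eqint f.
Proof.
move=> mf f1 ff ef.
have H (m : {measure set Rm -> \bar R}) : (m setT < +oo)%E ->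
    (\int[m]_x (f_ n x)%:E @[n --> \oo] --> \int[m]_x (f x)%:E)%E.
  move=> mfin; apply: (@dominated_cvg _ _ _ m _ measurableT (fun n x => (f_ n x)%:E) (EFin \o f) (cst 1%E)) => //.
  - by move=> n; apply/measurable_EFinP; exact: mf.
  - by move=> x _; apply: cvg_EFin; [exact: nearW|exact: ff].
  - by apply: (@bint _ (cst 1)) => //; exists 1 => x; rewrite normr1.
  - by move=> n x _; rewrite /= lee_fin f1.
have := H _ m1fin; under eq_cvg do rewrite ef.
by move=> h; exact: cvg_unique h (H _ m2fin).
Qed.

(** The phase turns the cosine into [sin (t * (x - z))]: the values lie in [[0, 1]] and are below
    [1 / 2] exactly where this sine is positive, as [cvg_polynomial_step] wants. *)
Let w (t z x : R) := (1 - cos ((- (pi / 2) - t * z) + t * x)) / 2.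

Let w01 t z x : 0 <= w t z x <= 1.
Proof.
have := cos_max (- (pi / 2) - t * z + t * x); rewrite ler_norml /w => /andP[? ?].
by apply/andP; split; lra.
Qed.

Let wE t z x : w t z x = (1 - sin (t * (x - z))) / 2.
Proof.
rewrite /w (_ : - (pi / 2) - t * z + t * x = t * (x - z) - pi / 2); last ring.
by rewrite cosBpihalf.
Qed.

Let trigw f t z n : trig f -> trig (fun x => f x * (w t z x) ^+ n).
Proof.
move=> tf; elim: n => [|n ih].
  by under eq_fun do rewrite expr0 mulr1.
(* [trigD] scales only its second argument, so [f w^n / 2] is reached as [f - (f - f w^n / 2)]. *)
have t0 : trig (fun x => 0 * f x + 2^-1 * (f x * w t z x ^+ n)).
  rewrite (_ : (fun x => _) = (fun x => f x + (-1) * (f x + (- 2^-1) * (f x * w t z x ^+ n)))).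
    by do 2 apply: trigD => //.
  by apply/funext => x; ring.
apply: (eq_trig (@trigD _ _ (-1) t0 (trigcos (- (pi / 2) - t * z) t t0))) => x.
by rewrite exprS /w; field.
Qed.

Let trig_step t z n : trig (fun x => (1 - w t z x ^+ (2 * n)) ^+ (n * 4 ^ n)).
Proof.
elim: (n * 4 ^ n)%N => [|k ih]; first by under eq_fun do rewrite expr0.
apply: (eq_trig (trigD (-1) ih (trigw t z (2 * n) ih))) => x.
by rewrite exprS; ring.
Qed.

(** Two limits. High powers first give the indicator of the set [A t] where [sin (t * (x - z))] is
    positive. Then [t] tends to [0]: once [t * |x - z| < pi], the sine has the sign of [x - z], so
    these sets converge pointwise to the ray. *)
Let measure_ray (z : R) : m1 `]z, +oo[%classic = m2 `]z, +oo[%classic.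
Proof.
pose A (t : R) := [set x : R | 0 < sin (t * (x - z))].
have mA t : measurable (A t).
  rewrite (_ : A t = (fun x => sin (t * (x - z))) @^-1` `]0, +oo[); last first.
    by apply/seteqP; split => x /=; rewrite in_itv/= andbT.
  rewrite -[X in measurable X]setTI; apply: (_ : measurable_fun _ _) => //.
  apply: measurableT_comp; first exact: (continuous_measurable_fun (@continuous_sin R)).
  by apply: measurable_funM => //; exact: measurable_funB.
have eA t : eqint (\1_(A t)).
  apply: (@eqint_lim (fun n x => (1 - w t z x ^+ (2 * n)) ^+ (n * 4 ^ n))).
  - by move=> n; case: (trig_step t z n).
  - move=> n x; have /andP[w0 w1] := w01 t z x.
    have ? : 0 <= w t z x ^+ (2 * n) <= 1 by rewrite exprn_ge0//= exprn_ile1.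
    by rewrite ger0_norm ?exprn_ge0 ?exprn_ile1//; lra.
  - move=> x; have := cvg_polynomial_step (w01 t z x).
    rewrite (_ : ((w t z x < 1 / 2)%R%:R : R) = \1_(A t) x)//.
    rewrite indicE; congr (nat_of_bool _)%:R; rewrite wE /A.
    apply/idP/idP => [H|]; last by rewrite inE/= => H; lra.
    by rewrite inE/=; lra.
  - by move=> n; exact: trig_eqint.
have : eqint (\1_(`]z, +oo[%classic)).
  apply: (@eqint_lim (fun n => \1_(A n.+1%:R^-1))) => //.
  - by move=> n x; rewrite indicE; case: (_ \in _); rewrite ?normr1 ?normr0.
  - move=> x; apply: cvg_near_cst.
    near=> n.
    rewrite !indicE; congr (nat_of_bool _)%:R.
    have npi : `|x - z| < n.+1%:R * pi.
      rewrite -ltr_pdivrMr ?pi_gt0// (@lt_le_trans _ _ n%:R)//; last by rewrite ler_nat.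
      by near: n; exact: nbhs_infty_gtr.
    have theta : n.+1%:R^-1 * `|x - z| < pi.
      by rewrite mulrC ltr_pdivrMr// mulrC.
    apply/idP/idP; rewrite /A !inE/= in_itv/= andbT.
    + apply: contraPP => /negP; rewrite -leNgt => xz.
      rewrite ler0_norm ?subr_le0// in theta.
      apply/negP; rewrite -leNgt -[_ * (x - z)]opprK sinN oppr_le0 -mulrN.
      by rewrite sin_ge0_pi// (ltW theta) andbT mulr_ge0// oppr_ge0 subr_le0.
    + move=> zx; rewrite gtr0_norm ?subr_gt0// in theta.
      by rewrite sin_gt0_pi// theta andbT mulr_gt0// subr_gt0.
by rewrite /eqint !integral_indic//= !setIT.
Unshelve. all: end_near. Qed.

(** Open rays are stable under intersection, exhaust the line and generate the Borel sets. *)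
Lemma measure_eq_cos (A : set R) : measurable A -> m1 A = m2 A.
Proof.
move=> mA.
apply: (@measure_unique _ _ Rm (@RGenOInfty.G R) (fun n => `](- n%:R), +oo[%classic)) => //.
- exact: RGenOInfty.measurableE.
- move=> _ _ [x ->] [y ->]; exists (Num.max x y).
  apply/seteqP; split => z /=; rewrite !in_itv/= !andbT gt_max.
    by move=> [-> ->].
  by move=> /andP[-> ->].
- by move=> i; exists (- i%:R).
- apply/seteqP; split => // x _; exists (Num.truncn `|x|).+1 => //=.
  rewrite in_itv/= andbT ltrNl (le_lt_trans (ler_norm _))// normrN.
  exact: truncnS_gt.
- by move=> _ [z ->]; exact: measure_ray.
- by move=> k; apply: le_lt_trans m1fin; apply: le_measure; rewrite ?inE.
Qed.

End characteristic.

(** * Measures from set functions, densities and images *)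

Section build_measure.
Context d (T : measurableType d) (R : realType).
Local Open Scope ereal_scope.

(** The structure is packed inside an existential, so that a measure can be created in the middle of
    a proof; the equality of underlying functions is what is rewritten with afterwards. *)
Lemma measure_of_fun (m : set T -> \bar R) :
  m set0 = 0 -> (forall A, 0 <= m A) -> semi_sigma_additive m ->
  exists mu : {measure set T -> \bar R}, (mu : set T -> \bar R) = m.
Proof.
move=> m0 mge0 madd; pose mix := isMeasure.Build _ T R m m0 mge0 madd.
by exists (HB.pack_for {measure set T -> \bar R} m mix).
Qed.

Lemma probability_of_fun (m : set T -> \bar R) :
  m set0 = 0 -> (forall A, 0 <= m A) -> semi_sigma_additive m ->
  m setT = 1 ->
  exists mu : probability T R, (mu : set T -> \bar R) = m.
Proof.
move=> m0 mge0 madd mT; pose mix := isMeasure.Build _ T R m m0 mge0 madd.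
pose mu : {measure set T -> \bar R} := HB.pack_for {measure set T -> \bar R} m mix.
pose mix2 := Measure_isProbability.Build _ T R mu mT.
by exists (HB.pack_for (probability T R) (Measure.sort mu) mix2).
Qed.

Lemma measure_weight (mu : {measure set T -> \bar R}) (f : T -> R) :
  measurable_fun setT f -> (forall x, 0 <= f x)%R ->
  exists nu : {measure set T -> \bar R}, is_density nu mu f.
Proof.
move=> mf f0.
have [|A|F mF tF mUF|nu nuE] := @measure_of_fun (fun A => \int[mu]_(x in A) (f x)%:E).
- exact: integral_set0.
- by apply: integral_ge0 => x _; rewrite lee_fin.
- by apply: semi_sigma_additive_nng_induced => //; exact/measurable_EFinP.
by exists nu; split=> //; split=> // A mA; rewrite nuE.
Qed.

Lemma measure_pushforward d' (T' : measurableType d')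
    (mu : {measure set T -> \bar R}) (phi : T -> T') :
  measurable_fun setT phi ->
  exists nu : {measure set T' -> \bar R}, (nu : set T' -> \bar R) = pushforward mu phi.
Proof. by move=> mphi; exists (@measure_function_pushforward__canonical__measure_function_Measure _ _ _ _ _ mu _ mphi). Qed.

End build_measure.

(** * Normal laws on the line *)

Section normal_law.
Context {R : realType}.
Local Notation mu := (@lebesgue_measure R).
Local Open Scope ereal_scope.
Implicit Types (s t m c : R) (F : R -> \bar R).

(** The image of Lebesgue measure under the affine map, scaled by [t], agrees with Lebesgue measure
    on half-open intervals and so equals it. *)
Lemma ge0_integral_affine (t c : R) F : (0 < t)%R ->
  measurable_fun [set: R] F -> (forall x, 0 <= F x) ->
  \int[mu]_x F x = t%:E * \int[mu]_x F (t * x + c)%R.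
Proof.
move=> t0 mF F0.
pose phi : measurableTypeR R -> measurableTypeR R := fun x => (t * x + c)%R.
have mphi : measurable_fun setT phi.
  by apply: measurable_funD => //; exact: measurable_funM.
have [nu nuE] := measure_pushforward mu mphi.
pose tn := NngNum (ltW t0).
rewrite (eq_measure_integral (mscale tn nu)); last first.
  move=> A mA _; apply: lebesgue_measure_unique => //= _ [[a b]] _ <-.
  rewrite /mscale nuE /pushforward /=.
  have -> : phi @^-1` `]a, b] = `]((a - c) / t)%R, ((b - c) / t)%R]%classic.
    by apply/seteqP; split => x /=; rewrite !in_itv/= /phi ltr_pdivrMr// ler_pdivlMr//
      ltrBlDr lerBrDr mulrC.
  rewrite !lebesgue_measure_itv/= !lte_fin ltr_pM2r ?invr_gt0// ltrD2r.
  case: ifPn => _; last by rewrite mule0.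
  by rewrite -!EFinB -EFinM; congr EFin; field; rewrite gt_eqF.
rewrite ge0_integral_mscale//; congr (_ * _).
by rewrite nuE ge0_integral_pushforward.
Qed.

Lemma ge0_integral_oppr F : measurable_fun [set: R] F -> (forall x, 0 <= F x) ->
  \int[mu]_x F x = \int[mu]_x F (- x)%R.
Proof.
move=> mF F0.
transitivity (\int[mu]_(x in (-%R : _ -> measurableTypeR R) @^-1` setT) (F \o -%R) x) => //.
rewrite -ge0_integral_pushforward//=.
by apply: eq_measure_integral => A mA _; exact/esym/lebesgue_measureN.
Qed.

Lemma normal_pdfM m s x : s != 0%R ->
  normal_pdf m s x = (normal_peak s * normal_fun m s x)%R.
Proof. by move=> s0; rewrite normal_pdfE. Qed.

Lemma normal_pdf_gt0 m s x : s != 0%R -> (0 < normal_pdf m s x)%R.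
Proof.
by move=> s0; rewrite normal_pdfM// mulr_gt0 ?expR_gt0 ?normal_peak_gt0.
Qed.

Lemma normal_pdf_center m s x : s != 0%R -> normal_pdf m s x = normal_pdf 0 s (x - m).
Proof. by move=> s0; rewrite !normal_pdfM// /normal_fun subr0. Qed.

Lemma measurable_normal_pdf2 (a s : R) : s != 0%R ->
  measurable_fun setT (fun p : R * R => normal_pdf (a * p.1) s p.2).
Proof.
move=> s0; under eq_fun do rewrite normal_pdf_center//.
apply: (@measurableT_comp _ _ _ _ _ _ (normal_pdf 0 s)); first exact: measurable_normal_pdf.
apply: measurable_funB; first exact: measurable_snd.
by apply: measurable_funM => //; exact: measurable_fst.
Qed.

Lemma measurable_normal_ratio d (T : measurableType d) (f g : T -> R) s s' :
  s != 0%R -> s' != 0%R -> measurable_fun setT f -> measurable_fun setT g ->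
  measurable_fun setT (fun x => normal_pdf (f x) s (g x) / normal_pdf 0 s' (g x))%R.
Proof.
move=> s0 s0' mf mg.
(* The inverse of a positive density is written [expR (- ln _)], a composition of measurable
   functions. *)
rewrite (_ : (fun x => _) = (fun x => normal_pdf 0 s (g x - f x) *
    expR (- ln (normal_pdf 0 s' (g x))))%R); last first.
  apply/funext => x; rewrite normal_pdf_center// expRN lnK// posrE.
  exact: normal_pdf_gt0.
apply: measurable_funM.
  apply: (@measurableT_comp _ _ _ _ _ _ (normal_pdf 0 s)); first exact: measurable_normal_pdf.
  exact: measurable_funB.
apply: measurableT_comp => //; apply: measurableT_comp => //.
apply: (@measurableT_comp _ _ _ _ _ _ (@ln R)); first exact: measurable_ln.
by apply: (@measurableT_comp _ _ _ _ _ _ (normal_pdf 0 s')) => //; exact: measurable_normal_pdf.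
Qed.

Lemma measurable_normal_pdf_mean (a s z : R) : s != 0%R ->
  measurable_fun [set: R] (fun y => normal_pdf (a * y) s z).
Proof.
move=> s0; under eq_fun do rewrite normal_pdf_center//.
apply: (@measurableT_comp _ _ _ _ _ _ (normal_pdf 0 s)); first exact: measurable_normal_pdf.
by apply: measurable_funB => //; exact: measurable_funM.
Qed.

(** Scaling by [t] yields standard deviations [t * s] of either sign; only the square matters. *)
Lemma normal_pdf_sqr m s s' x : (s ^+ 2 = s' ^+ 2)%R -> s != 0%R ->
  normal_pdf m s x = normal_pdf m s' x.
Proof.
move=> ss s0; have s0' : s' != 0%R by rewrite -sqrf_eq0 -ss sqrf_eq0.
by rewrite !normal_pdfM// /normal_peak /normal_fun ss.
Qed.

Lemma normal_prob_sqr m s s' : (s ^+ 2 = s' ^+ 2)%R -> s != 0%R ->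
  normal_prob m s = normal_prob m s'.
Proof.
move=> ss s0; apply/funext => A; rewrite /normal_prob.
by apply: eq_integral => x _; rewrite (normal_pdf_sqr _ _ ss).
Qed.

Lemma normal_prob_setT m s : normal_prob m s setT = 1.
Proof. by rewrite /normal_prob integral_normal_pdf. Qed.

Lemma integral_normal_cst m s (c : \bar R) : \int[normal_prob m s]_x c = c.
Proof.
rewrite (integral_cst (normal_prob m s) measurableT) -[RHS]mule1; congr (_ * _).
exact: normal_prob_setT.
Qed.

Lemma integral_normal_prob m s F : measurable_fun [set: R] F -> (forall x, 0 <= F x) ->
  \int[normal_prob m s]_x F x = \int[mu]_x (F x * (normal_pdf m s x)%:E).
Proof.
move=> mF F0; apply: is_density_ge0_integral => //; split.
  exact: measurable_normal_pdf.
by split => // x; exact: normal_pdf_ge0.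
Qed.

Lemma mule_normal_pdf_measurable m s F : measurable_fun [set: R] F ->
  measurable_fun [set: R] (fun x => F x * (normal_pdf m s x)%:E).
Proof.
move=> mF; apply: emeasurable_funM => //.
by apply/measurable_EFinP; exact: measurable_normal_pdf.
Qed.

Lemma mule_normal_pdf_ge0 m s F : (forall x, 0 <= F x) ->
  forall x, 0 <= F x * (normal_pdf m s x)%:E.
Proof. by move=> F0 x; rewrite mule_ge0// lee_fin normal_pdf_ge0. Qed.

Lemma normal_pdf_affine (t c m s x : R) : (0 < t)%R -> s != 0%R ->
  normal_pdf m s x = (t * normal_pdf (t * m + c) (t * s) (t * x + c))%R.
Proof.
move=> t0 s0; have ts0 : (t * s != 0)%R by rewrite mulf_neq0// gt_eqF.
rewrite !normal_pdfM// mulrA; congr (_ * _)%R.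
  rewrite /normal_peak.
  rewrite (_ : ((t * s) ^+ 2 * pi *+ 2 = t ^+ 2 * (s ^+ 2 * pi *+ 2))%R); last by ring.
  rewrite (sqrtrM (s ^+ 2 * pi *+ 2) (sqr_ge0 t)) sqrtr_sqr gtr0_norm//.
  by rewrite invfM mulrA divff ?mul1r// gt_eqF.
rewrite /normal_fun; congr expR; field.
by rewrite s0 gt_eqF.
Qed.

Lemma integral_normal_oppr m s F : s != 0%R ->
  measurable_fun [set: R] F -> (forall x, 0 <= F x) ->
  \int[normal_prob m s]_x F (- x)%R = \int[normal_prob (- m) s]_x F x.
Proof.
move=> s0 mF F0.
have mFN : measurable_fun [set: R] (fun x => F (- x)%R) by exact: measurableT_comp.
rewrite (integral_normal_prob _ _ mF F0).
rewrite [LHS]integral_normal_prob; [|exact: mFN|by []].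
rewrite [LHS]ge0_integral_oppr; last 2 first.
- exact: mule_normal_pdf_measurable.
- exact: mule_normal_pdf_ge0.
apply: eq_integral => x _; rewrite opprK; congr (_ * _%:E).
rewrite (normal_pdfM _ _ s0) (normal_pdfM _ _ s0) /normal_fun.
congr (_ * _)%R; congr expR.
congr (_ * _)%R.
by ring.
Qed.

Lemma integral_normal_affine (t c m s : R) F : t != 0%R -> s != 0%R ->
  measurable_fun [set: R] F -> (forall x, 0 <= F x) ->
  \int[normal_prob m s]_x F (t * x + c)%R = \int[normal_prob (t * m + c) (t * s)]_x F x.
Proof.
have pos t' m' F' : (0 < t')%R -> s != 0%R ->
  measurable_fun [set: R] F' -> (forall x, 0 <= F' x) ->
  \int[normal_prob m' s]_x F' (t' * x + c)%R =
    \int[normal_prob (t' * m' + c) (t' * s)]_x F' x.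
  move=> t0 s0 mF F0.
  have mFt : measurable_fun [set: R] (fun x => F' (t' * x + c)%R).
    apply: measurableT_comp => //.
    by apply: measurable_funD => //; exact: measurable_funM.
  rewrite (integral_normal_prob _ _ mF F0).
  rewrite [LHS]integral_normal_prob; [|exact: mFt|by []].
  rewrite [RHS](ge0_integral_affine c t0); last 2 first.
  - exact: mule_normal_pdf_measurable.
  - exact: mule_normal_pdf_ge0.
  rewrite -ge0_integralZl//; last 3 first.
  - apply: (@measurableT_comp _ _ _ _ _ _ (fun x => F' x * _%:E)).
      exact: mule_normal_pdf_measurable.
    by apply: measurable_funD => //; exact: measurable_funM.
  - by move=> x _; exact: mule_normal_pdf_ge0.
  - by rewrite lee_fin ltW.
  apply: eq_integral => x _.
  by rewrite (@normal_pdf_affine t' c)// EFinM muleCA.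
move=> t0 s0 mF F0; have [tp|] := ltP 0%R t; first exact: pos.
rewrite le_eqVlt (negbTE t0)/= => tn.
(* A negative slope is the positive slope [- t] applied to the reflected variable. *)
have := pos (- t)%R (- m)%R F; rewrite oppr_gt0 => /(_ tn s0 mF F0).
rewrite mulrNN => H.
have E : normal_prob (t * m + c) (t * s) = normal_prob (t * m + c) (- t * s).
  by apply: normal_prob_sqr; [rewrite mulNr sqrrN|rewrite mulf_neq0].
rewrite E; apply: etrans H; rewrite -(@integral_normal_oppr m s (fun x => F (- t * x + c)%R) s0).
- by apply: eq_integral => x _; rewrite mulrNN.
- apply: measurableT_comp => //.
  by apply: measurable_funD => //; exact: measurable_funM.
- by [].
Qed.

(* Completing the square: the joint density of [(u, y)] with [u ~ N(0, s)] and
   [y | u ~ N(a u, t)] factors as the law of [y] times the law of [u | y]. *)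
Lemma normal_pdf_bayes (a s t u y : R) : s != 0%R -> t != 0%R ->
  let q := Num.sqrt (t ^+ 2 + a ^+ 2 * s ^+ 2) in
  (normal_pdf (a * u) t y * normal_pdf 0 s u =
   normal_pdf 0 q y * normal_pdf (a * s ^+ 2 * y / q ^+ 2) (s * t / q) u)%R.
Proof.
move=> s0 t0 q.
have Q0 : (0 < t ^+ 2 + a ^+ 2 * s ^+ 2)%R.
  by rewrite ltr_pwDl ?exprn_even_gt0// mulr_ge0// sqr_ge0.
have q0 : q != 0%R by rewrite gt_eqF// sqrtr_gt0.
have q2 : (q ^+ 2 = t ^+ 2 + a ^+ 2 * s ^+ 2)%R by rewrite sqr_sqrtr// ltW.
have stq : (s * t / q != 0)%R by rewrite mulf_neq0 ?invr_eq0// mulf_neq0.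
rewrite !normal_pdfM// mulrACA [RHS]mulrACA; congr (_ * _)%R.
  have pk (v : R) : (0 <= v ^+ 2 * pi *+ 2)%R.
    by rewrite mulrn_wge0// (mulr_ge0 (sqr_ge0 v) (pi_ge0 R)).
  rewrite /normal_peak -!invfM -!sqrtrM ?pk//.
  congr (_ ^-1)%R; congr Num.sqrt; rewrite exprMn exprVn exprMn.
  move: (q ^+ 2)%R (expf_neq0 2 q0) => Q hQ; rewrite -[LHS]mulr1 -(divff hQ); ring.
rewrite /normal_fun -!expRD; congr expR.
rewrite expr_div_n q2 exprMn; field.
by rewrite s0 t0 exprMn gt_eqF.
Qed.

(** After [normal_pdf_bayes], only the law of [u] given [y] depends on [u], and it has mass 1. *)
Lemma integral_normal_mixture (a s t y : R) : s != 0%R -> t != 0%R ->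
  \int[mu]_u (normal_pdf (a * u) t y * normal_pdf 0 s u)%:E =
  (normal_pdf 0 (Num.sqrt (t ^+ 2 + a ^+ 2 * s ^+ 2)) y)%:E.
Proof.
move=> s0 t0; under eq_integral do rewrite normal_pdf_bayes// EFinM.
rewrite ge0_integralZl ?integral_normal_pdf ?mule1 ?lee_fin ?normal_pdf_ge0//.
- by apply/measurable_EFinP; exact: measurable_normal_pdf.
- by move=> x _; rewrite lee_fin normal_pdf_ge0.
Qed.

(** For fixed [y] and [t != 0], the variable [z = t x + u y] is normal with mean [u y]; exchanging
    the integrals, [integral_normal_mixture] integrates [y] out. When [t = 0], [z] has no density
    given [y], hence the separate case, where [s != 0] forces [u != 0]. *)
Lemma integral_normal_lin2 (s1 s2 t u s : R) F : s1 != 0%R -> s2 != 0%R -> s != 0%R ->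
  (s ^+ 2 = t ^+ 2 * s1 ^+ 2 + u ^+ 2 * s2 ^+ 2)%R ->
  measurable_fun [set: R] F -> (forall x, 0 <= F x) ->
  \int[normal_prob 0 s1]_x \int[normal_prob 0 s2]_y F (t * x + u * y)%R =
  \int[normal_prob 0 s]_z F z.
Proof.
move=> s10 s20 s0 sE mF F0; have [t0|t0] := eqVneq t 0%R.
  have u0 : u != 0%R.
    apply: contra_neq s0 => u0; apply/eqP; rewrite -sqrf_eq0 sE t0 u0 expr0n/=.
    by rewrite !mul0r addr0.
  transitivity (\int[normal_prob 0 s1]_x (cst (\int[normal_prob 0 s2]_y F (u * y + 0)%R)) x).
    by apply: eq_integral => x _; apply: eq_integral => y _; rewrite t0 mul0r addrC.
  rewrite integral_normal_cst.
  rewrite (integral_normal_affine 0 0 u0 s20 mF F0) mulr0 addr0.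
  have -> : normal_prob 0 s = normal_prob 0 (u * s2).
    by apply: normal_prob_sqr s0; rewrite sE t0 expr0n/= mul0r add0r exprMn.
  by [].
have mlin : measurable_fun [set: R * R] (fun p : R * R => (t * p.1 + u * p.2)%R).
  by apply: measurable_funD; apply: measurable_funM.
have mFlin : measurable_fun setT (fun p : R * R => F (t * p.1 + u * p.2)%R).
  exact: measurableT_comp.
apply: (etrans (@fubini_tonelli _ _ _ _ R (normal_prob 0 s1) (normal_prob 0 s2)
  (fun p => F (t * p.1 + u * p.2)%R) mFlin (fun p => F0 _))).
transitivity (\int[mu]_y \int[mu]_z
   (F z * (normal_pdf (u * y) (t * s1) z * normal_pdf 0 s2 y)%:E)).
  rewrite integral_normal_prob; last 2 first.
  - exact: (@measurable_fun_fubini_tonelli_G _ _ _ _ R (normal_prob 0 s1)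
      (fun p => F (t * p.1 + u * p.2)%R) mFlin (fun p => F0 _)).
  - by move=> y; exact: integral_ge0.
  apply: eq_integral => y _ /=.
  rewrite (integral_normal_affine (u * y) 0 t0 s10 mF F0) mulr0 add0r.
  rewrite (integral_normal_prob _ _ mF F0) -ge0_integralZr; last 4 first.
  - by [].
  - exact: mule_normal_pdf_measurable.
  - by move=> x _; exact: mule_normal_pdf_ge0.
  - by rewrite lee_fin normal_pdf_ge0.
  by apply: eq_integral => z _; rewrite EFinM muleA.
have ts1 : (t * s1 != 0)%R by rewrite mulf_neq0.
have mFpdf : measurable_fun setT (fun p : R * R =>
   (F p.2 * (normal_pdf (u * p.1) (t * s1) p.2 * normal_pdf 0 s2 p.1)%:E)).
  apply: emeasurable_funM; first by apply: measurableT_comp => //; exact: measurable_snd.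
  apply/measurable_EFinP; apply: measurable_funM; first exact: measurable_normal_pdf2.
  by apply: measurableT_comp; [exact: measurable_normal_pdf|exact: measurable_fst].
apply: (etrans (@fubini_tonelli _ _ _ _ R mu mu (fun p =>
  F p.2 * (normal_pdf (u * p.1) (t * s1) p.2 * normal_pdf 0 s2 p.1)%:E) mFpdf _)).
  by move=> x; rewrite mule_ge0// lee_fin mulr_ge0// normal_pdf_ge0.
rewrite (integral_normal_prob _ _ mF F0); apply: eq_integral => z _ /=.
rewrite ge0_integralZl; last 4 first.
- by [].
- apply/measurable_EFinP; apply: measurable_funM; last exact: measurable_normal_pdf.
  exact: measurable_normal_pdf_mean.
- by move=> x _; rewrite lee_fin mulr_ge0// normal_pdf_ge0.
- exact: F0.
rewrite (integral_normal_mixture _ _ s20 ts1); congr (_ * _%:E).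
apply/esym/normal_pdf_sqr => //; rewrite sqr_sqrtr; first by rewrite exprMn sE.
exact: (addr_ge0 (sqr_ge0 _) (mulr_ge0 (sqr_ge0 _) (sqr_ge0 _))).
Qed.

Lemma integral_normal_ratio m s s' F : s != 0%R -> s' != 0%R ->
  measurable_fun [set: R] F -> (forall x, 0 <= F x) ->
  \int[normal_prob 0 s']_x ((normal_pdf m s x / normal_pdf 0 s' x)%:E * F x) =
  \int[normal_prob m s]_x F x.
Proof.
move=> s0 s0' mF F0; rewrite [LHS]integral_normal_prob; last 2 first.
- apply: emeasurable_funM => //; apply/measurable_EFinP.
  exact: (measurable_normal_ratio (f := cst m) (g := id)).
- by move=> x; rewrite mule_ge0// lee_fin divr_ge0// normal_pdf_ge0.
rewrite (integral_normal_prob _ _ mF F0); apply: eq_integral => x _.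
by rewrite [RHS]muleC muleAC -EFinM divfK// gt_eqF// normal_pdf_gt0.
Qed.

(** The exponential changes the exponent of the density from variance [s^2] to [s'^2]; what remains
    is the ratio of the peaks. *)
Lemma integral_normal_expR_sqr (s s' : R) : (0 < s)%R -> (0 < s')%R ->
  \int[normal_prob 0 s]_x (expR ((s ^- 2 - s' ^- 2) / 2 * x ^+ 2))%:E = (s' / s)%:E.
Proof.
move=> s0 s0'; rewrite integral_normal_prob; last 2 first.
- apply/measurable_EFinP; apply: measurableT_comp => //.
  by apply: measurable_funM => //; exact: measurable_funX.
- by move=> x; rewrite lee_fin expR_ge0.
under eq_integral => x _.
  rewrite (_ : _ * _ = (s' / s)%:E * (normal_pdf 0 s' x)%:E); last first.
    rewrite -!EFinM; congr EFin; rewrite !normal_pdfM ?gt_eqF// /normal_fun mulrCA -expRD.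
    rewrite [RHS]mulrA; congr (_ * _)%R; last by congr expR; field; rewrite !gt_eqF.
    rewrite /normal_peak -!mulrnAr !(sqrtrM _ (sqr_ge0 _)) !sqrtr_sqr !gtr0_norm// !invfM.
    by field; rewrite !gt_eqF// sqrtr_gt0 mulrn_wgt0// pi_gt0.
  over.
rewrite ge0_integralZl ?integral_normal_pdf ?mule1 ?lee_fin ?divr_ge0 ?ltW//.
- by apply/measurable_EFinP; exact: measurable_normal_pdf.
- by move=> x _; rewrite lee_fin normal_pdf_ge0.
Qed.

(* Comparing [1 + e x^2] with [exp (e x^2)] for [e] of either sign squeezes the
   second moment between difference quotients of [s' / s]. *)
Lemma integral_normal_sqr (s : R) : s != 0%R ->
  \int[normal_prob 0 s]_x (x ^+ 2)%:E = (s ^+ 2)%:E.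
Proof.
wlog s0 : s / (0 < s)%R => [wl s0|_].
  have s2 : (`|s| ^+ 2 = s ^+ 2)%R by rewrite real_normK ?num_real.
  have -> : normal_prob 0 s = normal_prob 0 `|s|%R by apply: normal_prob_sqr s0.
  by rewrite -s2; apply: wl; rewrite ?normr_gt0 ?normr_eq0.
have mX : measurable_fun [set: R] (fun x => (x ^+ 2)%:E).
  by apply/measurable_EFinP; exact: measurable_funX.
have X0 (x : R) : 0 <= (x ^+ 2)%:E by rewrite lee_fin sqr_ge0.
set M := \int[_]_x _; have M0 : 0 <= M by exact: integral_ge0.
pose e s' := ((s ^- 2 - s' ^- 2) / 2)%R.
have mE s' : measurable_fun [set: R] (fun x => (expR (e s' * x ^+ 2))%:E).
  apply/measurable_EFinP; apply: measurableT_comp => //.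
  by apply: measurable_funM => //; exact: measurable_funX.
have up s' : (s < s')%R -> 1 + (e s')%:E * M <= (s' / s)%:E.
  move=> ss'; rewrite -integral_normal_expR_sqr//; last exact: lt_trans ss'.
  have e0 : (0 <= e s')%R.
    rewrite /e divr_ge0// subr_ge0 lef_pV2 ?posrE ?exprn_gt0// ?(lt_trans s0 ss')//.
    by rewrite lerXn2r ?nnegrE ?ltW// (lt_trans s0).
  have -> : 1 + (e s')%:E * M =
      \int[normal_prob 0 s]_x (1 + (e s')%:E * (x ^+ 2)%:E).
    rewrite ge0_integralD//; last 2 first.
    - by move=> x _; rewrite mule_ge0.
    - exact: measurable_funeM.
    by rewrite integral_normal_cst ge0_integralZl.
  apply: ge0_le_integral => //.
  - by move=> x _; rewrite adde_ge0// mule_ge0.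
  - by apply: emeasurable_funD => //; exact: measurable_funeM.
  - exact: mE.
  - by move=> x _; rewrite -EFinM -EFinD lee_fin expR_ge1Dx.
have dn s' : (0 < s')%R -> (s' < s)%R -> 1 <= (s' / s)%:E + (- e s')%:E * M.
  move=> s'0 ss'; rewrite -integral_normal_expR_sqr//.
  have e0 : (0 <= - e s')%R.
    rewrite /e -mulNr divr_ge0// opprB subr_ge0 lef_pV2 ?posrE ?exprn_gt0//.
    by rewrite lerXn2r ?nnegrE ?ltW.
  rewrite -ge0_integralZl// -ge0_integralD//; last 3 first.
  - exact: mE.
  - by move=> x _; rewrite mule_ge0.
  - exact: measurable_funeM.
  rewrite -[leLHS](_ : \int[normal_prob 0 s]_x (cst 1) x = 1); last first.
    exact: integral_normal_cst.
  apply: ge0_le_integral => //.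
  - by apply: emeasurable_funD; [exact: mE|exact: measurable_funeM].
  - move=> x _; rewrite -EFinM -EFinD lee_fin.
    by have := expR_ge1Dx (e s' * x ^+ 2); rewrite /e; lra.
(* At [s' = 2 s] the coefficient [e s'] is positive, so an infinite moment would contradict [up]. *)
have Mfin : M \is a fin_num.
  rewrite ge0_fin_numE//; have := up (2 * s)%R; rewrite ltr_pMl// ltr1n => /(_ isT).
  move=> H; rewrite ltey; apply/eqP => My; move: H; rewrite My gt0_muley ?addey//.
  rewrite lte_fin /e divr_gt0// subr_gt0 ltf_pV2 ?posrE ?exprn_gt0 ?mulr_gt0//.
  by rewrite ltrXn2r ?nnegrE ?mulr_ge0 ?ltW// ltr_pMl// ltr1n.
move: up dn M0; rewrite -(fineK Mfin); set K := fine M => up dn; rewrite lee_fin => K0.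
congr EFin; pose k := (K / s ^+ 2)%R.
have KE : (K = k * s ^+ 2)%R by rewrite /k divfK// expf_neq0// gt_eqF.
have k0 : (0 <= k)%R by rewrite /k divr_ge0// sqr_ge0.
have eE r : (0 < r)%R -> (e (r * s) * K = (1 - r ^- 2) / 2 * k)%R.
  by move=> r0; rewrite KE /e; field; rewrite !gt_eqF.
suff k1 : k = 1%R by rewrite KE k1 mul1r.
apply/eqP; rewrite eq_le; apply/andP; split; rewrite leNgt; apply/negP => kk.
(* At [s' = r s], [up] becomes [r^2 + (r^2 - 1) k / 2 <= r^3]. The choice [k = 3 r - 2] turns this
   into [(r - 1)^2 (r + 2) <= 0], which is false. *)
- pose r := (1 + (k - 1) / 3)%R; have r1 : (1 < r)%R by rewrite /r; lra.
  have r0 : (0 < r)%R by lra.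
  have := up (r * s)%R; rewrite ltr_pMl// => /(_ r1).
  rewrite -EFinM -EFinD lee_fin eE// mulfK ?gt_eqF// => H.
  have : ((r ^+ 2 + (r ^+ 2 - 1) / 2 * k) <= r ^+ 3)%R.
    have := ler_wpM2l (ltW (exprn_gt0 2 r0)) H.
    rewrite mulrDr mulr1 -exprSr => H2; apply: le_trans H2.
    by rewrite le_eqVlt; apply/orP; left; apply/eqP; field; rewrite gt_eqF.
  rewrite (_ : k = 3 * r - 2)%R; last by rewrite /r; field.
  have : (0 < (r - 1) * (r - 1) * (r + 2))%R by rewrite !mulr_gt0//; lra.
  by rewrite !exprS expr0; lra.
(* Again [k = 3 r - 2], and [dn] leads to the same false inequality; [k >= 0] keeps [r] positive. *)
- pose r := (1 - (1 - k) / 3)%R; have r1 : (r < 1)%R by rewrite /r; lra.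
  have r0 : (0 < r)%R by rewrite /r; lra.
  have := dn (r * s)%R; rewrite mulr_gt0// gtr_pMl// => /(_ isT r1).
  rewrite -EFinM -EFinD lee_fin mulNr eE// mulfK ?gt_eqF// => H.
  have : (r ^+ 2 <= r ^+ 3 + (1 - r ^+ 2) / 2 * k)%R.
    have := ler_wpM2l (ltW (exprn_gt0 2 r0)) H; rewrite mulr1 mulrDr -exprSr => H2.
    apply: (le_trans H2); rewrite le_eqVlt; apply/orP; left; apply/eqP.
    by field; rewrite gt_eqF.
  have kE : (k = 3 * r - 2)%R by rewrite /r; field.
  have : (0 < (1 - r) * (1 - r) * (r + 2))%R by rewrite !mulr_gt0//; lra.
  by rewrite kE !exprS expr0; lra.
Qed.

(** By reflection the shifts [a] and [- a] give the same integral, and adding the two cancels the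
    cross term. Only nonnegative integrands occur, and no first moment is computed. *)
Lemma integral_normal_sqr_sub m s c : s != 0%R ->
  \int[normal_prob m s]_x ((x - c) ^+ 2)%:E = (s ^+ 2 + (m - c) ^+ 2)%:E.
Proof.
move=> s0.
have mX (a : R) : measurable_fun [set: R] (fun x => ((x + a) ^+ 2)%:E).
  by apply/measurable_EFinP; apply: measurable_funX; exact: measurable_funD.
have X0 (a x : R) : 0 <= ((x + a) ^+ 2)%:E by rewrite lee_fin sqr_ge0.
pose J (a : R) := \int[normal_prob 0 s]_x ((x + a) ^+ 2)%:E.
have JN a : J (- a)%R = J a.
  have := integral_normal_oppr 0 s0 (mX a) (X0 a); rewrite oppr0 /J => <-.
  by apply: eq_integral => x _; congr EFin; ring.
have J2 a : J a + J (- a)%R = (2 * (s ^+ 2 + a ^+ 2))%:E.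
  rewrite /J -(ge0_integralD (normal_prob 0 s) measurableT (fun x _ => X0 a x) (mX a)
    (fun x _ => X0 (- a)%R x) (mX (- a)%R)).
  under eq_integral => x _.
    rewrite -EFinD (_ : _ + _ = 2 * x ^+ 2 + 2 * a ^+ 2)%R; last by ring.
    rewrite EFinD EFinM; over.
  have mX2 : measurable_fun [set: R] (fun x => (x ^+ 2)%:E).
    by apply/measurable_EFinP; exact: measurable_funX.
  rewrite ge0_integralD//; last 3 first.
  - by move=> x _; rewrite mule_ge0 ?lee_fin ?sqr_ge0.
  - exact: measurable_funeM.
  - by move=> x _; rewrite lee_fin mulr_ge0 ?sqr_ge0.
  rewrite ge0_integralZl; [|by []|exact: mX2|by move=> x _; rewrite lee_fin sqr_ge0|by []].
  rewrite integral_normal_sqr// integral_normal_cst.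
  by rewrite -EFinM -EFinD mulrDr.
have JE a : J a = (s ^+ 2 + a ^+ 2)%:E.
  have := J2 a; rewrite JN; have : 0 <= J a by exact: integral_ge0.
  case: (J a) => //= r _; rewrite -EFinD => -[H]; congr EFin; lra.
rewrite -JE /J.
have := integral_normal_affine m 0 (oner_neq0 R) s0 (mX (- c)%R) (X0 (- c)%R).
rewrite mulr0 add0r mul1r => <-; apply: eq_integral => x _.
by rewrite mul1r addrA.
Qed.

End normal_law.

(** * From the line to the plane *)

Section weighted_image.
Context d (T : measurableType d) (R : realType).
Local Notation Rm := (measurableTypeR R).
Local Open Scope ereal_scope.
Implicit Types (m : {measure set T -> \bar R}) (f w : T -> R).

(** Weighting [m] before taking its image allows a theorem about measures on the line to be applied
    to a measure on the plane, the weight testing the other coordinate. *)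
Lemma measure_weight_image m w (M : R) (phi : T -> Rm) : m setT < +oo ->
  measurable_fun setT w -> (forall x, 0 <= w x <= M)%R ->
  measurable_fun setT phi ->
  exists n : {measure set Rm -> \bar R}, [/\ n setT < +oo,
    forall S, measurable S -> n S = \int[m]_(z in phi @^-1` S) (w z)%:E &
    forall f : R -> R, measurable_fun [set: R] f -> (exists K, forall x, `|f x| <= K)%R ->
      \int[n]_x (f x)%:E = \int[m]_z (f (phi z) * w z)%:E].
Proof.
move=> mfin mw w0M mphi.
have w0 x : (0 <= w x)%R by have /andP[] := w0M x.
have [nu dnu] := measure_weight m mw w0; have [_ [_ nuE]] := dnu.
have [n nE] := measure_pushforward nu mphi.
have iw : m.-integrable setT (EFin \o w).
  by apply: (@integrable_bounded _ _ _ m w M) => // x; have /andP[? ?] := w0M x; rewrite ger0_norm.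
have nufin : nu setT < +oo by rewrite nuE//; exact: integrable_lty iw.
exists n; split.
- by rewrite nE /pushforward preimage_setT.
- move=> S mS; rewrite nE /pushforward nuE//.
  by rewrite -[X in measurable X]setTI; exact: mphi.
- move=> f mf [K fK].
  have mfphi : measurable_fun setT (fun z => f (phi z)) by exact: measurableT_comp mf mphi.
  have ifnu : nu.-integrable setT (EFin \o (fun z => f (phi z))).
    exact: (@integrable_bounded _ _ _ nu (fun z => f (phi z)) K).
  rewrite nE integral_pushforward//.
    rewrite preimage_setT (is_density_integrable dnu ifnu).2.
    by apply: eq_integral => z _; rewrite /= -EFinM.
  exact/measurable_EFinP.
Qed.

End weighted_image.

Section characteristic2.
Context {R : realType}.
Local Notation Rm := (measurableTypeR R).
Local Open Scope ereal_scope.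

Let mcos2 (b t u : R) : measurable_fun setT (fun z : Rm * Rm => cos (b + t * z.1 + u * z.2)).
Proof.
apply: measurableT_comp; first exact: (continuous_measurable_fun (@continuous_cos R)).
by apply: measurable_funD; [apply: measurable_funD => //|]; apply: measurable_funM.
Qed.

Let icos2 (m : {measure set (Rm * Rm) -> \bar R}) b t u : m setT < +oo ->
  m.-integrable setT (fun z : Rm * Rm => (cos (b + t * z.1 + u * z.2))%:E).
Proof.
move=> mfin; apply: (@integrable_bounded _ _ _ m _ 1%R) => // x; exact: cos_max.
Qed.

Let mcos (b t : R) : measurable_fun [set: R] (fun x => cos (b + t * x)).
Proof.
apply: measurableT_comp; first exact: (continuous_measurable_fun (@continuous_cos R)).
by apply: measurable_funD => //; exact: measurable_funM.
Qed.

Let bcos (b t : R) : exists K : R, forall x : R, (`|cos (b + t * x)| <= K)%R.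
Proof. by exists 1%R => x; exact: cos_max. Qed.

(** The weight [1 + cos] is nonnegative, and its product with a cosine of the first coordinate is a
    combination of cosines on the plane, whose integrals are the given data. *)
Let cos_weight (m : {measure set (Rm * Rm) -> \bar R}) (b' u : R) : m setT < +oo ->
  exists n : {measure set Rm -> \bar R}, [/\ n setT < +oo,
    forall S, measurable S ->
      n S = \int[m]_(z in fst @^-1` S) (1 + cos (b' + 0 * z.1 + u * z.2))%:E &
    forall b t, \int[n]_x (cos (b + t * x))%:E =
      \int[m]_z (cos (b + t * z.1 + 0 * z.2))%:E +
      (2^-1)%:E * (\int[m]_z (cos (b + b' + t * z.1 + u * z.2))%:E +
                 \int[m]_z (cos (b - b' + t * z.1 + (- u) * z.2))%:E)].
Proof.
move=> mfin.
have [|||n [nfin nE nI]] := @measure_weight_image _ _ R m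
  (fun z : Rm * Rm => 1 + cos (b' + 0 * z.1 + u * z.2))%R 2 fst mfin.
- by apply: measurable_funD.
- move=> x; have := cos_max (b' + 0 * x.1 + u * x.2); rewrite ler_norml => /andP[? ?].
  by apply/andP; split; lra.
- exact: measurable_fst.
exists n; split=> // b t; rewrite nI//.
rewrite -(integralD measurableT (icos2 _ _ _ mfin) (icos2 _ _ _ mfin)).
rewrite -integralZl//; last by apply: integrableD => //; exact: icos2.
rewrite -integralD//; last 2 first.
- exact: icos2.
- by apply: integrableZl => //; apply: integrableD => //; exact: icos2.
apply: eq_integral => z _.
rewrite -(EFinD (cos (b + b' + _ + _))) -(EFinM 2^-1) -(EFinD (cos (b + _ + _))); congr EFin.
rewrite !mul0r !addr0.
rewrite (_ : b + b' + t * z.1 + u * z.2 = (b + t * z.1) + (b' + u * z.2))%R; last by ring.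
rewrite (_ : b - b' + t * z.1 + - u * z.2 = (b + t * z.1) - (b' + u * z.2))%R; last by ring.
by move: (b + t * z.1)%R (b' + u * z.2)%R => x y; rewrite cosB cosD; field.
Qed.

(** A cosine is [(1 + cos) - 1], and the constant [1] is written as [1 + cos (pi / 2 + ...)], so
    that both integrals over the strip have the form delivered by [cos_weight]. *)
Let strip_weight (m : {measure set (Rm * Rm) -> \bar R}) (S : set Rm) : m setT < +oo ->
  measurable S ->
  exists n : {measure set Rm -> \bar R}, [/\ n setT < +oo,
    forall S', measurable S' -> n S' = m (S `*` S') &
    forall b t, \int[n]_x (cos (b + t * x))%:E =
      \int[m]_(z in fst @^-1` S) (1 + cos (b + 0 * z.1 + t * z.2))%:E -
      \int[m]_(z in fst @^-1` S) (1 + cos (pi / 2 + 0 * z.1 + 0 * z.2))%:E].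
Proof.
move=> mfin mS.
have mSf : measurable (fst @^-1` S : set (Rm * Rm)).
  by rewrite -[X in measurable X]setTI; exact: measurable_fst.
have [|||n [nfin nE nI]] := @measure_weight_image _ _ R m
  (\1_(fst @^-1` S : set (Rm * Rm))) 1 snd mfin.
- exact: measurable_indic.
- by move=> x; rewrite indicE; case: (_ \in _) => /=; rewrite !lexx ?ler01.
- exact: measurable_snd.
exists n; split=> // [S' mS'|b t].
  rewrite nE// integral_indic//.
  by rewrite -[X in measurable X]setTI; exact: measurable_snd.
rewrite nI//.
have iB t' b'' : m.-integrable (fst @^-1` S) (EFin \o
    (fun z : Rm * Rm => 1 + cos (b'' + 0 * z.1 + t' * z.2))%R).
  apply: (@integrableS _ _ _ m setT) => //.
  apply: (@integrable_bounded _ _ _ m _ 2%R) => //; first exact: measurable_funD.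
  move=> x; have := cos_max (b'' + 0 * x.1 + t' * x.2); rewrite !ler_norml => /andP[? ?].
  by apply/andP; split; lra.
rewrite -integralB//; [|exact: iB|exact: iB].
rewrite [RHS]integral_mkcond; apply: eq_integral => z _.
rewrite patchE indicE !mul0r !addr0 cos_pihalf addr0.
case: ifPn => _ /=; last by rewrite mulr0.
by rewrite -EFinD; congr EFin; ring.
Qed.

(** The theorem on the line is used twice: with a cosine weight in the second coordinate it gives
    equality of the weighted masses of strips, and with the indicator of a strip as weight it gives
    equality on rectangles. *)
Lemma measure_eq_cos2 (p q : {measure set (Rm * Rm) -> \bar R}) :
  p setT < +oo -> q setT < +oo ->
  (forall b t u : R, \int[p]_z (cos (b + t * z.1 + u * z.2))%:E =
                     \int[q]_z (cos (b + t * z.1 + u * z.2))%:E) ->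
  forall X, measurable X -> p X = q X.
Proof.
move=> pfin qfin pq.
have st b u S : measurable S ->
    \int[p]_(z in fst @^-1` S) (1 + cos (b + 0 * z.1 + u * z.2))%:E =
    \int[q]_(z in fst @^-1` S) (1 + cos (b + 0 * z.1 + u * z.2))%:E.
  move=> mS.
  have [n [nf nE nI]] := cos_weight b u pfin.
  have [n' [nf' nE' nI']] := cos_weight b u qfin.
  rewrite -nE// -nE'//; apply: measure_eq_cos => // b' t.
  by rewrite nI nI' !pq.
have rect S S' : measurable S -> measurable S' -> p (S `*` S') = q (S `*` S').
  move=> mS mS'.
  have [n [nf nE nI]] := strip_weight pfin mS.
  have [n' [nf' nE' nI']] := strip_weight qfin mS.
  rewrite -nE// -nE'//; apply: measure_eq_cos => // b' t.
  by rewrite nI nI' !st.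
pose C : set (set (Rm * Rm)) :=
  [set C | exists A, measurable A /\ exists B, measurable B /\ C = A `*` B].
move=> X mX; apply: (measure_unique C (fun n => setT `*` setT)) => //.
- rewrite measurable_prod_measurableType //; congr (<<s _ >>).
  rewrite predeqE; split => [[A mA [B mB <-]]|[A [mA [B [mB ->]]]]].
    by exists A; split => //; exists B.
  by exists A => //; exists B.
- move=> /= _ _ [X1 [mX1 [X2 [mX2 ->]]]] [Y1 [mY1 [Y2 [mY2 ->]]]].
  rewrite -setXI; exists (X1 `&` Y1); split; first exact: measurableI.
  by exists (X2 `&` Y2); split => //; exact: measurableI.
- by move=> n; exists setT; split=> //; exists setT.
- by apply/seteqP; split=> // z _; exists 0%N.
- by move=> _ [A [mA [B [mB ->]]]]; exact: rect.
- by move=> k; rewrite setXTT.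
Qed.

End characteristic2.

Lemma measurable_fun_bigprod d (T : measurableType d) (R : realType) (I : Type)
    (r : seq I) (P : pred I) (h : I -> T -> R) :
  (forall i, measurable_fun setT (h i)) ->
  measurable_fun setT (fun x => \prod_(i <- r | P i) h i x).
Proof.
move=> mh; elim: r => [|i r ih].
  by under eq_fun do rewrite big_nil; exact: measurable_cst.
under eq_fun do rewrite big_cons.
by case: (P i) => //; exact: measurable_funM.
Qed.

(** * Independence of jointly normal coordinates *)

Section normal_pair.
Context d (T : measurableType d) (R : realType).
Local Notation Rm := (measurableTypeR R).
Local Open Scope ereal_scope.
Variables (m : {measure set T -> \bar R}) (c : R) (A B : T -> R) (s1 s2 : R).
Hypotheses (c0 : (0 <= c)%R) (mA : measurable_fun setT A) (mB : measurable_fun setT B).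
Hypotheses (s10 : s1 != 0%R) (s20 : s2 != 0%R).
Hypothesis law : forall (t u s : R) (F : R -> \bar R), s != 0%R ->
  (s ^+ 2 = t ^+ 2 * s1 ^+ 2 + u ^+ 2 * s2 ^+ 2)%R ->
  measurable_fun [set: R] F -> (forall x, 0 <= F x) ->
  \int[m]_x F (t * A x + u * B x)%R = c%:E * \int[normal_prob 0 s]_z F z.

Let N1 : probability Rm R := normal_prob 0 s1.
Let N2 : probability Rm R := normal_prob 0 s2.

Let mT : m setT = c%:E.
Proof.
have := @law 1 0 s1 (cst 1) s10; rewrite expr0n/= mul0r addr0 expr1n mul1r => /(_ erefl).
move=> /(_ (measurable_cst _) (fun=> lee01)).
by rewrite integral_normal_cst (integral_cst m measurableT) mul1e mule1.
Qed.

Let phi (x : T) : Rm * Rm := (A x, B x).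

Let mphi : measurable_fun setT phi. Proof. exact: measurable_fun_pair. Qed.

(** [law] speaks of nonnegative functions, so the cosine is shifted by [1]; [integral_sub1] undoes
    the shift. *)
Let F1 (b z : R) : \bar R := (1 + cos (b + z))%:E.

Let mF1 b : measurable_fun [set: R] (F1 b).
Proof.
apply/measurable_EFinP; apply: measurable_funD => //; apply: measurableT_comp.
  exact: (continuous_measurable_fun (@continuous_cos R)).
exact: measurable_funD.
Qed.

Let F10 b z : 0 <= F1 b z.
Proof. by have := cos_max (b + z); rewrite lee_fin ler_norml => /andP[? ?]; lra. Qed.

Let integral_1cos b t u : \int[m]_x F1 b (t * A x + u * B x) =
  c%:E * \int[N1]_x \int[N2]_y F1 b (t * x + u * y).
Proof.
(* [law] requires a nonzero variance; for the zero combination both sides integrate a constant. *)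
have [/andP[/eqP-> /eqP->]|tu] := boolP ((t == 0%R) && (u == 0%R)).
  transitivity (\int[m]_x (cst (F1 b 0)) x).
    by apply: eq_integral => x _; rewrite !mul0r addr0.
  rewrite (integral_cst m measurableT) mT muleC; apply: (congr1 (fun x => c%:E * x)).
  transitivity (\int[N1]_x (F1 b 0)); first by rewrite integral_normal_cst.
  apply: eq_integral => x _; apply/esym.
  transitivity (\int[N2]_x (F1 b 0)); last by rewrite integral_normal_cst.
  by apply: eq_integral => y _; rewrite !mul0r addr0.
pose s := Num.sqrt (t ^+ 2 * s1 ^+ 2 + u ^+ 2 * s2 ^+ 2).
have v0 : (0 < t ^+ 2 * s1 ^+ 2 + u ^+ 2 * s2 ^+ 2)%R.
  rewrite lt0r (addr_ge0 (mulr_ge0 (sqr_ge0 _) (sqr_ge0 _)) (mulr_ge0 (sqr_ge0 _) (sqr_ge0 _))) andbT.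
  rewrite -!exprMn paddr_eq0 ?sqr_ge0// !sqrf_eq0 !mulf_eq0.
  by rewrite (negbTE s10) (negbTE s20) !orbF.
have s0 : s != 0%R by rewrite gt_eqF// sqrtr_gt0.
have sE : (s ^+ 2 = t ^+ 2 * s1 ^+ 2 + u ^+ 2 * s2 ^+ 2)%R by rewrite sqr_sqrtr// ltW.
apply: (etrans (law s0 sE (mF1 b) (F10 b))); apply: congr1.
exact: (esym (integral_normal_lin2 s10 s20 s0 sE (mF1 b) (F10 b))).
Qed.

Let integral_sub1 d' (U : measurableType d') (n : {measure set U -> \bar R}) (f : U -> R) :
  n setT = c%:E -> measurable_fun setT f -> (forall x, `|f x| <= 1)%R ->
  \int[n]_x (f x)%:E = \int[n]_x (1 + f x)%:E - c%:E.
Proof.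
move=> nT mf f1; have nfin : n setT < +oo by rewrite nT ltry.
have i1 : n.-integrable setT (EFin \o cst 1%R).
  by apply: (@integrable_bounded _ _ _ n _ 1%R) => // x; rewrite normr1.
have if_ : n.-integrable setT (EFin \o f) by exact: (@integrable_bounded _ _ _ n _ 1%R).
under [in RHS]eq_integral do rewrite EFinD.
have i1E : \int[n]_x (EFin \o cst 1%R) x = c%:E.
  by apply: (etrans (integral_cst n measurableT 1)); rewrite nT mul1e.
rewrite (integralD measurableT i1 if_) i1E.
by rewrite addeAC subee// add0e.
Qed.

(** The image of [m] under [(A, B)] and [c] times the product of the two normal laws have the same
    cosine integrals, since a cosine sees only one combination [t A + u B]. A general mass [c] is
    allowed because [m] will be a weighted probability. *)
Lemma ge0_integral_normal_pair (F G : R -> \bar R) :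
  measurable_fun [set: R] F -> (forall x, 0 <= F x) ->
  measurable_fun [set: R] G -> (forall x, 0 <= G x) ->
  \int[m]_x (F (A x) * G (B x)) =
  c%:E * (\int[normal_prob 0 s1]_x F x * \int[normal_prob 0 s2]_x G x).
Proof.
move=> mF F0 mG G0.
have [p pE] := measure_pushforward m mphi.
pose q : {measure set (Rm * Rm) -> \bar R} := mscale (NngNum c0) (N1 \x N2).
have qE X : q X = c%:E * (N1 \x N2) X by [].
have pT : p setT = c%:E by rewrite pE /pushforward preimage_setT.
have qT : q setT = c%:E by rewrite qE [X in _ * X]probability_setT mule1.
have qI (H : Rm * Rm -> \bar R) : measurable_fun setT H -> (forall z, 0 <= H z) ->
    \int[q]_z H z = c%:E * \int[N1]_x \int[N2]_y H (x, y).
  move=> mH H0; apply: (etrans (ge0_integral_mscale _ measurableT _ mH (fun z _ => H0 z))).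
  by apply: (congr1 (fun x => c%:E * x)); exact: fubini_tonelli1.
have pI (H : Rm * Rm -> \bar R) : measurable_fun setT H -> (forall z, 0 <= H z) ->
    \int[p]_z H z = \int[m]_x H (phi x).
  move=> mH H0; rewrite pE.
  exact: (etrans (ge0_integral_pushforward mphi m measurableT mH (fun z _ => H0 z))).
have pq X : measurable X -> p X = q X.
  have pfin : p setT < +oo by rewrite pT ltry.
  have qfin : q setT < +oo by rewrite qT ltry.
  move: X; apply: (measure_eq_cos2 pfin qfin) => b t u.
  have mc : measurable_fun setT (fun z : Rm * Rm => cos (b + t * z.1 + u * z.2)).
    apply: measurableT_comp; first exact: (continuous_measurable_fun (@continuous_cos R)).
    by apply: measurable_funD; [apply: measurable_funD => //|]; apply: measurable_funM.
  have mc1 : measurable_fun setT (fun z : Rm * Rm => (1 + cos (b + t * z.1 + u * z.2))%:E).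
    by apply/measurable_EFinP; exact: measurable_funD.
  have c10 (z : Rm * Rm) : 0 <= (1 + cos (b + t * z.1 + u * z.2))%:E.
    by have := F10 b (t * z.1 + u * z.2); rewrite /F1 addrA.
  rewrite (integral_sub1 pT mc (fun z => cos_max _)) (integral_sub1 qT mc (fun z => cos_max _)).
  rewrite (pI _ mc1 c10) (qI _ mc1 c10); apply: (congr1 (fun x => x - c%:E)).
  transitivity (\int[m]_x F1 b (t * A x + u * B x)).
    by apply: eq_integral => x _; rewrite /F1 addrA.
  apply: (etrans (integral_1cos b t u)); apply: congr1; apply: eq_integral => x _.
  by apply: eq_integral => y _; rewrite /F1 addrA.
have mFG : measurable_fun setT (fun z : Rm * Rm => F z.1 * G z.2).
  apply: emeasurable_funM.
    by apply: (@measurableT_comp _ _ _ _ _ _ F); [exact: mF|exact: measurable_fst].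
  by apply: (@measurableT_comp _ _ _ _ _ _ G); [exact: mG|exact: measurable_snd].
have FG0 (z : Rm * Rm) : 0 <= F z.1 * G z.2 by exact: mule_ge0.
transitivity (\int[p]_z (F z.1 * G z.2)); first by rewrite (pI _ mFG FG0).
transitivity (\int[q]_z (F z.1 * G z.2)).
  by apply: eq_measure_integral => X mX _; exact: pq.
rewrite (qI _ mFG FG0); apply: (congr1 (fun x => c%:E * x)).
have iG0 : 0 <= \int[N2]_y G y by exact: integral_ge0.
apply: (etrans _ (ge0_integralZr N1 measurableT mF (fun x _ => F0 x) iG0)).
apply: eq_integral => x _ /=.
exact: (ge0_integralZl N2 measurableT mG (fun x _ => G0 x) (F0 x)).
Qed.

End normal_pair.

Section normal_independence.
Context d (T : measurableType d) (R : realType) (L : nat).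
Local Open Scope ereal_scope.
Variables (P : probability T R) (Y : 'I_L -> T -> R) (lam : 'I_L -> R).
Hypotheses (mY : forall l, measurable_fun setT (Y l)) (lam0 : forall l, (0 < lam l)%R).
Hypothesis linear_law : forall (a : 'I_L -> R) (F : R -> \bar R), (exists l, a l != 0%R) ->
  measurable_fun [set: R] F -> (forall x, 0 <= F x) ->
  \int[P]_x F (\sum_(l < L) a l * Y l x)%R =
  \int[normal_prob 0 (Num.sqrt (\sum_(l < L) a l ^+ 2 * lam l))]_z F z.

Variables (F : 'I_L -> R -> R) (c : 'I_L -> R).
Hypotheses (mF : forall l, measurable_fun [set: R] (F l)) (F0 : forall l x, (0 <= F l x)%R).
Hypothesis Fc : forall l, \int[normal_prob 0 (Num.sqrt (lam l))]_x (F l x)%:E = (c l)%:E.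

Let c0 l : (0 <= c l)%R.
Proof. by rewrite -lee_fin -Fc; apply: integral_ge0 => x _; rewrite lee_fin. Qed.

Let W k x : R := (\prod_(l < L | (l < k)%N) F l (Y l x))%R.
Let C k : R := (\prod_(l < L | (l < k)%N) c l)%R.

Let mW k : measurable_fun setT (W k).
Proof.
by apply: measurable_fun_bigprod => l; exact: (@measurableT_comp _ _ _ _ _ _ (F l)).
Qed.

Let W0 k x : (0 <= W k x)%R. Proof. exact: prodr_ge0. Qed.

Let C0 k : (0 <= C k)%R. Proof. exact: prodr_ge0. Qed.

Let WS (k : 'I_L) x : W k.+1 x = (W k x * F k (Y k x))%R.
Proof.
rewrite /W (bigD1 k)//= mulrC; congr (_ * _)%R; apply: eq_bigl => l.
by rewrite ltnS ltn_neqAle -val_eqE andbC.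
Qed.

Let CS (k : 'I_L) : C k.+1 = (C k * c k)%R.
Proof.
rewrite /C (bigD1 k)//= mulrC; congr (_ * _)%R; apply: eq_bigl => l.
by rewrite ltnS ltn_neqAle -val_eqE andbC.
Qed.

(* Under the measure weighted by [W k], coordinate [k] and any combination of the
   later ones form a normal pair, whose law is a product: this gives the step. *)
Let weighted_law k : (k <= L)%N ->
  \int[P]_x (W k x)%:E = (C k)%:E /\
  forall (a : 'I_L -> R) (G : R -> \bar R), (exists l, a l != 0%R) ->
    (forall l : 'I_L, (l < k)%N -> a l = 0%R) ->
    measurable_fun [set: R] G -> (forall x, 0 <= G x) ->
  \int[P]_x ((W k x)%:E * G (\sum_(l < L) a l * Y l x)%R) =
  (C k)%:E * \int[normal_prob 0 (Num.sqrt (\sum_(l < L) a l ^+ 2 * lam l))]_z G z.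
Proof.
elim: k => [_|k ih kL].
  have W1 x : W 0 x = 1%R by rewrite /W big_pred0.
  have C1 : C 0 = 1%R by rewrite /C big_pred0.
  rewrite C1; split=> [|a G a0 _ mG G0].
    under eq_integral do rewrite W1.
    by rewrite (integral_cst P measurableT) [X in _ * X]probability_setT mule1.
  rewrite mul1e -(linear_law a0 mG G0).
  by apply: eq_integral => x _; rewrite W1 mul1e.
pose k' := Ordinal kL.
have [_ IH] := ih (ltnW kL).
pose e (l : 'I_L) : R := (l == k')%:R.
have e0 : exists l, e l != 0%R by exists k'; rewrite /e eqxx oner_neq0.
have elt (l : 'I_L) : (l < k)%N -> e l = 0%R.
  by move=> lk; rewrite /e; case: eqP => // E; move: lk; rewrite E ltnn.
have eY x : (\sum_(l < L) e l * Y l x = Y k' x)%R.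
  rewrite (bigD1 k')//= /e eqxx mul1r big1 ?addr0// => l /negbTE ->.
  by rewrite mul0r.
have elam : (\sum_(l < L) e l ^+ 2 * lam l = lam k')%R.
  rewrite (bigD1 k')//= /e eqxx expr1n mul1r big1 ?addr0// => l /negbTE ->.
  by rewrite expr0n mul0r.
have mFk : measurable_fun [set: R] (EFin \o F k') by exact/measurable_EFinP.
have Fk0 x : 0 <= (EFin \o F k') x by rewrite lee_fin.
split.
  have := IH e _ e0 elt mFk Fk0; rewrite elam Fc -EFinM -(CS k') => <-.
  by apply: eq_integral => x _; rewrite (WS k') eY.
move=> a G a0 ak mG G0.
have [m dm] := measure_weight P (mW k) (W0 k).
pose B x : R := (\sum_(l < L) a l * Y l x)%R.
have mB : measurable_fun setT B.
  by apply: measurable_sum => l; exact: measurable_funM.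
pose be : R := (\sum_(l < L) a l ^+ 2 * lam l)%R.
have be0 : (0 < be)%R.
  have [l al] := a0; rewrite /be (bigD1 l)//= ltr_pwDl//.
    by rewrite mulr_gt0// exprn_even_gt0.
  by apply: sumr_ge0 => i _; rewrite mulr_ge0 ?sqr_ge0// ltW.
have sq (v : R) : (0 < v)%R -> (Num.sqrt v != 0)%R by move=> v0; rewrite gt_eqF// sqrtr_gt0.
have law (t u s : R) (H : R -> \bar R) : s != 0%R ->
    (s ^+ 2 = t ^+ 2 * Num.sqrt (lam k') ^+ 2 + u ^+ 2 * Num.sqrt be ^+ 2)%R ->
    measurable_fun [set: R] H -> (forall x, 0 <= H x) ->
    \int[m]_x H (t * Y k' x + u * B x)%R = (C k)%:E * \int[normal_prob 0 s]_z H z.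
  move=> s0; rewrite !sqr_sqrtr ?ltW// => sE mH H0.
  pose al l : R := (t * e l + u * a l)%R.
  have alE x : (\sum_(l < L) al l * Y l x = t * Y k' x + u * B x)%R.
    rewrite -eY /B !mulr_sumr -big_split/=; apply: eq_bigr => l _.
    by rewrite /al mulrDl !mulrA.
  have alv : (\sum_(l < L) al l ^+ 2 * lam l = s ^+ 2)%R.
    rewrite sE -elam /be !mulr_sumr -big_split/=; apply: eq_bigr => l _.
    (* [e] lives at coordinate [k] and [a] strictly beyond it, so the cross term of the variance
       vanishes. *)
    have : (e l * a l = 0)%R.
      by rewrite /e; case: eqP => [->|_]; [rewrite ak ?mulr0//= |rewrite mul0r].
    move=> ea; transitivity (t ^+ 2 * (e l ^+ 2 * lam l) + u ^+ 2 * (a l ^+ 2 * lam l) +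
      2 * t * u * lam l * (e l * a l))%R; first by rewrite /al; ring.
    by rewrite ea mulr0 addr0.
  have al0 : exists l, al l != 0%R.
    apply/not_existsP => aln; move: s0; rewrite -sqrf_eq0 -alv big1 ?eqxx// => l _.
    by have /negP := aln l; rewrite negbK => /eqP ->; rewrite expr0n mul0r.
  have allt (l : 'I_L) : (l < k)%N -> al l = 0%R.
    by move=> lk; rewrite /al (elt l lk) (ak l (leqW lk)) !mulr0 addr0.
  have mHB : measurable_fun setT (fun x => H (t * Y k' x + u * B x)%R).
    apply: (@measurableT_comp _ _ _ _ _ _ H) => //.
    by apply: measurable_funD; exact: measurable_funM.
  have -> : normal_prob 0 s = normal_prob 0 (Num.sqrt (\sum_(l < L) al l ^+ 2 * lam l)).
    by apply: normal_prob_sqr s0; rewrite alv sqr_sqrtr// sqr_ge0.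
  rewrite -(IH al H al0 allt mH H0) (is_density_ge0_integral dm mHB) => [|x]; last exact: H0.
  by apply: eq_integral => x _; rewrite alE muleC.
have mFG : measurable_fun setT (fun x => (EFin \o F k') (Y k' x) * G (B x)).
  apply: emeasurable_funM.
    exact: (@measurableT_comp _ _ _ _ _ _ (EFin \o F k')).
  exact: (@measurableT_comp _ _ _ _ _ _ G).
transitivity (\int[m]_x ((EFin \o F k') (Y k' x) * G (B x))).
  rewrite (is_density_ge0_integral dm mFG) => [|x]; last exact: mule_ge0.
  apply: eq_integral => x _; rewrite (WS k') EFinM.
  by rewrite [RHS]muleC muleA.
apply: (etrans (ge0_integral_normal_pair (C0 k) (mY k') mB (sq _ (lam0 k')) (sq _ be0)
  law mFk Fk0 mG G0)).
rewrite (CS k') EFinM -muleA; apply: congr1.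
by apply: (congr1 (fun v => v * _)); exact: Fc.
Qed.

Lemma integral_prod_normal :
  \int[P]_x (\prod_(l < L) F l (Y l x))%:E = (\prod_(l < L) c l)%:E.
Proof.
have [H _] := weighted_law (leqnn L).
have -> : (\prod_(l < L) c l = C L)%R by apply: eq_bigl => l; rewrite ltn_ord.
rewrite -H; apply: eq_integral => x _; congr EFin; apply: eq_bigl => l.
by rewrite ltn_ord.
Qed.

End normal_independence.

Lemma probability_pushforward d d' (T : measurableType d) (T' : measurableType d')
    (R : realType) (P : probability T R) (phi : T -> T') :
  measurable_fun setT phi ->
  exists nu : probability T' R, (nu : set T' -> \bar R) = pushforward P phi.
Proof.
move=> mphi; have [m mE] := measure_pushforward P mphi.
apply: probability_of_fun.
- by rewrite -mE measure0.
- by move=> A; rewrite -mE measure_ge0.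
- by rewrite -mE; exact: measure_semi_sigma_additive.
- by rewrite /pushforward preimage_setT probability_setT.
Qed.

(** * Gaussian log-likelihood ratios and their integrals *)

Section gaussian_test.
Context {R : realType}.
Implicit Types (b s v y : R).

Lemma ln_sqrt v : 0 < v -> ln (Num.sqrt v) = ln v / 2.
Proof.
move=> v0; have := lnXn 2 (_ : 0 < Num.sqrt v); rewrite sqrtr_gt0 => /(_ v0).
by rewrite sqr_sqrtr ?ltW//; lra.
Qed.

(** Logarithm at [y] of the density of the normal law of mean [b] and variance [v] relative to the
    centred one of variance [lam]; see [normal_ratioE]. *)
Definition log_ratio (lam b v y : R) : R :=
  (ln (lam / v) - (y - b) ^+ 2 / v + y ^+ 2 / lam) / 2.

Lemma normal_ratioE (lam b v y : R) : 0 < lam -> 0 < v ->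
  normal_pdf b (Num.sqrt v) y / normal_pdf 0 (Num.sqrt lam) y =
  expR (log_ratio lam b v y).
Proof.
move=> lam0 v0.
have sv : Num.sqrt v != 0 by rewrite gt_eqF// sqrtr_gt0.
have sl : Num.sqrt lam != 0 by rewrite gt_eqF// sqrtr_gt0.
rewrite !normal_pdfM// /normal_peak /normal_fun !sqr_sqrtr ?ltW//.
have pk (u : R) : 0 <= u -> Num.sqrt (u * pi *+ 2) = Num.sqrt u * Num.sqrt (pi *+ 2).
  by move=> u0; rewrite -mulrnAr sqrtrM.
rewrite !pk ?ltW//.
have p0 : Num.sqrt (pi *+ 2) != 0 :> R.
  by rewrite gt_eqF// sqrtr_gt0 mulrn_wgt0// pi_gt0.
have -> : log_ratio lam b v y =
    ln (Num.sqrt lam) - ln (Num.sqrt v) + (- (y - b) ^+ 2 / (v *+ 2) + y ^+ 2 / (lam *+ 2)).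
  rewrite !ln_sqrt// /log_ratio ln_div ?posrE//.
  by field; rewrite !gt_eqF.
rewrite !expRD expRN !lnK ?posrE ?sqrtr_gt0// !invfM !invrK subr0.
rewrite (_ : - y ^+ 2 / (lam *+ 2) = - (y ^+ 2 / (lam *+ 2))); last by rewrite mulNr.
rewrite expRN invrK; field.
by rewrite sv p0.
Qed.

End gaussian_test.

Section independent_normals.
Context d (T : measurableType d) (R : realType) (L : nat).
Local Open Scope ereal_scope.
Variables (mu : probability T R) (Y : 'I_L -> T -> R) (lam : 'I_L -> R).
Hypotheses (mY : forall l, measurable_fun setT (Y l)) (lam0 : forall l, (0 < lam l)%R).
Hypothesis indep : forall (F : 'I_L -> R -> R) (c : 'I_L -> R),
  (forall l, measurable_fun [set: R] (F l)) -> (forall l x, (0 <= F l x)%R) ->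
  (forall l, \int[normal_prob 0 (Num.sqrt (lam l))]_x (F l x)%:E = (c l)%:E) ->
  \int[mu]_x (\prod_(l < L) F l (Y l x))%:E = (\prod_(l < L) c l)%:E.

Let sq0 (v : R) : (0 < v)%R -> (Num.sqrt v != 0)%R.
Proof. by move=> v0; rewrite gt_eqF// sqrtr_gt0. Qed.

Lemma measurable_log_ratio (l b v : R) :
  measurable_fun [set: R] (fun y => log_ratio l b v y).
Proof.
apply: measurable_funM => //; apply: measurable_funD; last first.
  by apply: measurable_funM => //; exact: measurable_funX.
apply: measurable_funB => //; apply: measurable_funM => //; apply: measurable_funX.
exact: measurable_funB.
Qed.

(** Under the tilted law the coordinates are independent with means [b] and variances [v], so the
    other coordinates contribute a factor [1]. *)
Lemma integral_expR_log_ratio_mul (b v : 'I_L -> R) (k : 'I_L) (G : R -> R) (g : R) :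
  (forall l, 0 < v l)%R -> measurable_fun [set: R] G -> (forall x, 0 <= G x)%R ->
  \int[normal_prob (b k) (Num.sqrt (v k))]_y (G y)%:E = g%:E ->
  \int[mu]_x (expR (\sum_(l < L) log_ratio (lam l) (b l) (v l) (Y l x)) * G (Y k x))%:E = g%:E.
Proof.
move=> v0 mG G0 Gg.
pose H (l : 'I_L) (y : R) : R := if l == k then G y else 1%R.
have mH l : measurable_fun [set: R] (H l) by rewrite /H; case: (l == k).
have H0 l y : (0 <= H l y)%R by rewrite /H; case: (l == k).
pose F l y := (expR (log_ratio (lam l) (b l) (v l) y) * H l y)%R.
have -> : g%:E = (\prod_(l < L) (if l == k then g else 1))%:E.
  rewrite (bigD1 k)//= eqxx big1 ?mulr1// => i /negbTE ->//.
rewrite -(@indep F).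
- apply: eq_integral => x _; congr EFin.
  rewrite expR_sum /F big_split/=; congr (_ * _)%R.
  by rewrite (bigD1 k)//= /H eqxx big1 ?mulr1// => i /negbTE ->.
- move=> l; apply: measurable_funM => //; apply: measurableT_comp => //.
  exact: measurable_log_ratio.
- by move=> l x; rewrite mulr_ge0 ?expR_ge0.
- move=> l.
  transitivity (\int[normal_prob 0 (Num.sqrt (lam l))]_x
    ((normal_pdf (b l) (Num.sqrt (v l)) x / normal_pdf 0 (Num.sqrt (lam l)) x)%:E * (H l x)%:E)).
    by apply: eq_integral => x _; rewrite /F normal_ratioE// EFinM.
  rewrite (integral_normal_ratio _ (sq0 (v0 l)) (sq0 (lam0 l)) (F := EFin \o H l)); last 2 first.
  - exact/measurable_EFinP.
  - by move=> x; rewrite lee_fin.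
  rewrite /H; case: eqP => [->|_]; first exact: Gg.
  exact: integral_normal_cst.
Qed.

(** This is the normalisation needed by [donsker_varadhan]. It is proved separately from the
    previous lemma, whose coordinate [k] exists only when [0 < L]. *)
Lemma integral_expR_log_ratio (b v : 'I_L -> R) : (forall l, 0 < v l)%R ->
  \int[mu]_x (expR (\sum_(l < L) log_ratio (lam l) (b l) (v l) (Y l x)))%:E = 1.
Proof.
move=> v0; pose F l y := expR (log_ratio (lam l) (b l) (v l) y).
have -> : 1 = (\prod_(l < L) (fun=> 1%R : R) l)%:E :> \bar R by rewrite big1.
rewrite -(@indep F).
- by apply: eq_integral => x _; congr EFin; rewrite expR_sum.
- by move=> l; apply: measurableT_comp => //; exact: measurable_log_ratio.
- by move=> l x; exact: expR_ge0.
- move=> l.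
  transitivity (\int[normal_prob 0 (Num.sqrt (lam l))]_x
    ((normal_pdf (b l) (Num.sqrt (v l)) x / normal_pdf 0 (Num.sqrt (lam l)) x)%:E * (cst 1) x)).
    by apply: eq_integral => x _; rewrite /F normal_ratioE// mule1.
  rewrite (integral_normal_ratio _ (sq0 (v0 l)) (sq0 (lam0 l))); last 2 first.
  - exact: measurable_cst.
  - by move=> x.
  exact: integral_normal_cst.
Qed.

Lemma integral_sqr_coordinate k : \int[mu]_x (Y k x ^+ 2)%:E = (lam k)%:E.
Proof.
(* With mean [0] and variance [lam] the log ratio is zero, so nothing is tilted. *)
have := @integral_expR_log_ratio_mul (fun=> 0%R) lam k (fun y => y ^+ 2)%R (lam k) lam0.
move=> <-.
- apply: eq_integral => x _; congr EFin; rewrite big1 ?expR0 ?mul1r// => l _.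
  rewrite /log_ratio divff ?gt_eqF// ln1 subr0; lra.
- exact: measurable_funX.
- by move=> x; exact: sqr_ge0.
- by rewrite integral_normal_sqr ?sq0// sqr_sqrtr// ltW.
Qed.

End independent_normals.

Section quadratic_integrals.
Context d (U : measurableType d) (R : realType) (Q : probability U R).
Local Open Scope ereal_scope.

Lemma ge0_integrable_fin (f : U -> R) (r : R) : measurable_fun setT f ->
  (forall x, 0 <= f x)%R -> \int[Q]_x (f x)%:E = r%:E -> Q.-integrable setT (EFin \o f).
Proof.
move=> mf f0 fr; apply/integrableP; split; first exact/measurable_EFinP.
under eq_integral do rewrite /= ger0_norm//.
by rewrite fr ltry.
Qed.

Lemma integral_lincomb3 (f g h : U -> R) (a b c A B C : R) :
  Q.-integrable setT (EFin \o f) -> Q.-integrable setT (EFin \o g) ->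
  Q.-integrable setT (EFin \o h) ->
  \int[Q]_x (f x)%:E = A%:E -> \int[Q]_x (g x)%:E = B%:E -> \int[Q]_x (h x)%:E = C%:E ->
  Q.-integrable setT (EFin \o (fun x => a * f x + b * g x + c * h x)%R) /\
  \int[Q]_x (a * f x + b * g x + c * h x)%:E = (a * A + b * B + c * C)%:E.
Proof.
move=> iF iG iH fA gB hC.
have i1 := integrableZl measurableT a iF.
have i2 := integrableZl measurableT b iG.
have i3 := integrableZl measurableT c iH.
have i12 := integrableD measurableT i1 i2.
split.
  apply: (eq_integrable measurableT) (integrableD measurableT i12 i3) => x _.
  by rewrite /= !EFinD !EFinM.
transitivity (\int[Q]_x ((a%:E * (EFin \o f) x + b%:E * (EFin \o g) x) + c%:E * (EFin \o h) x)).
  by apply: eq_integral => x _; rewrite /= !EFinD !EFinM.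
rewrite (integralD measurableT i12 i3) (integralD measurableT i1 i2).
by rewrite !integralZl// fA gB hC -!EFinM -!EFinD.
Qed.

(** The log ratio is a combination of [1], [(p - b)^2] and [p^2]: this is why only second moments
    enter the bounds. *)
Lemma integral_log_ratio (p b : U -> R) (lam v A B : R) :
  measurable_fun setT p -> measurable_fun setT b ->
  \int[Q]_x ((p x - b x) ^+ 2)%:E = A%:E -> \int[Q]_x (p x ^+ 2)%:E = B%:E ->
  Q.-integrable setT (EFin \o (fun x => log_ratio lam (b x) v (p x))) /\
  \int[Q]_x (log_ratio lam (b x) v (p x))%:E = ((ln (lam / v) - A / v + B / lam) / 2)%:E.
Proof.
move=> mp mb hA hB.
have i1 : Q.-integrable setT (EFin \o (fun x => (p x - b x) ^+ 2)%R).
  apply: ge0_integrable_fin hA; last by move=> x; exact: sqr_ge0.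
  by apply: measurable_funX; exact: measurable_funB.
have i2 : Q.-integrable setT (EFin \o (fun x => p x ^+ 2)%R).
  by apply: ge0_integrable_fin hB; [exact: measurable_funX|move=> x; exact: sqr_ge0].
have hC : \int[Q]_x ((cst 1%R : U -> R) x)%:E = 1%:E.
  apply: (etrans (integral_cst Q measurableT 1)).
  by rewrite [X in _ * X]probability_setT mule1.
have i3 : Q.-integrable setT (EFin \o cst 1%R).
  by apply: ge0_integrable_fin hC; [exact: measurable_cst|move=> x; exact: ler01].
have [iI EI] := integral_lincomb3 (ln (lam / v) / 2) (- (v^-1 / 2)) (lam^-1 / 2) i3 i1 i2 hC hA hB.
have E x : (ln (lam / v) / 2 * cst 1 x + - (v^-1 / 2) * (p x - b x) ^+ 2 +
    lam^-1 / 2 * p x ^+ 2 = log_ratio lam (b x) v (p x))%R.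
  by rewrite /log_ratio /=; ring.
split.
  by apply: (eq_integrable measurableT) iI => x _; rewrite /= -E.
rewrite -[LHS](_ : \int[Q]_x (ln (lam / v) / 2 * cst 1 x +
    - (v^-1 / 2) * (p x - b x) ^+ 2 + lam^-1 / 2 * p x ^+ 2)%:E = _).
  by rewrite EI; congr EFin; ring.
by apply: eq_integral => x _; rewrite E.
Qed.

Lemma integral_sum_log_ratio L (p b : 'I_L -> U -> R) (lam v A B : 'I_L -> R) :
  (forall l, measurable_fun setT (p l)) -> (forall l, measurable_fun setT (b l)) ->
  (forall l, \int[Q]_x ((p l x - b l x) ^+ 2)%:E = (A l)%:E) ->
  (forall l, \int[Q]_x (p l x ^+ 2)%:E = (B l)%:E) ->
  Q.-integrable setT
    (EFin \o (fun x => \sum_(l < L) log_ratio (lam l) (b l x) (v l) (p l x))%R) /\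
  \int[Q]_x (\sum_(l < L) log_ratio (lam l) (b l x) (v l) (p l x))%:E =
    (\sum_(l < L) (ln (lam l / v l) - A l / v l + B l / lam l) / 2)%:E.
Proof.
move=> mp mb hA hB.
have H l := integral_log_ratio (lam l) (v l) (mp l) (mb l) (hA l) (hB l).
have H1 l := (H l).1.
split.
  rewrite (_ : _ \o _ = (fun x => \sum_(l < L) (log_ratio (lam l) (b l x) (v l) (p l x))%:E)).
    by apply: integrable_sum => // l _; exact: H1.
  by apply/funext => x; rewrite /= sumEFin.
transitivity (\int[Q]_x \sum_(l < L) (log_ratio (lam l) (b l x) (v l) (p l x))%:E).
  by apply: eq_integral => x _; rewrite sumEFin.
rewrite (integral_sum measurableT) => [|l]; last exact: H1.
by rewrite -sumEFin; apply: eq_bigr => l _; rewrite (H l).2.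
Qed.

End quadratic_integrals.

(** * Lower bound on the mutual information *)

Section converse.
Context d (T : measurableType d) (R : realType) (L : nat).
Local Open Scope ereal_scope.
Variables (mu : probability T R) (Y : 'I_L -> T -> R) (lam : 'I_L -> R).
Hypotheses (mY : forall l, measurable_fun setT (Y l)) (lam0 : forall l, (0 < lam l)%R).
Hypothesis indep : forall (F : 'I_L -> R -> R) (c : 'I_L -> R),
  (forall l, measurable_fun [set: R] (F l)) -> (forall l x, (0 <= F l x)%R) ->
  (forall l, \int[normal_prob 0 (Num.sqrt (lam l))]_x (F l x)%:E = (c l)%:E) ->
  \int[mu]_x (\prod_(l < L) F l (Y l x))%:E = (\prod_(l < L) c l)%:E.

Variables (D P : R) (pi : probability (T * T)%type R).
Hypothesis marg1E : marg1 pi = mu.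
Hypothesis distortion :
  \int[pi]_z (\sum_(l < L) (Y l z.1 - Y l z.2) ^+ 2)%:E <= D%:E.
Hypothesis perception : KL (marg2 pi) mu <= P%:E.
Hypothesis rate_fin : mutual_info pi < +oo.

Let mX l : measurable_fun setT (fun z : T * T => Y l z.1).
Proof. exact: (@measurableT_comp _ _ _ _ _ _ (Y l) _ fst). Qed.

Let mXh l : measurable_fun setT (fun z : T * T => Y l z.2).
Proof. exact: (@measurableT_comp _ _ _ _ _ _ (Y l) _ snd). Qed.

Let EX l : \int[pi]_z (Y l z.1 ^+ 2)%:E = (lam l)%:E.
Proof.
rewrite -(integral_sqr_coordinate lam0 indep l).
have -> : \int[mu]_x (Y l x ^+ 2)%:E = \int[pushforward pi fst]_x (Y l x ^+ 2)%:E.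
  by rewrite -marg1E.
rewrite ge0_integral_pushforward//.
- by apply/measurable_EFinP; exact: measurable_funX.
- by move=> x _; rewrite lee_fin sqr_ge0.
Qed.

Let Ediff : exists de : 'I_L -> R, (forall l,
  \int[pi]_z ((Y l z.1 - Y l z.2) ^+ 2)%:E = (de l)%:E) /\ (\sum_(l < L) de l <= D)%R.
Proof.
have mS l : measurable_fun setT (fun z : T * T => ((Y l z.1 - Y l z.2) ^+ 2)%:E).
  by apply/measurable_EFinP; apply: measurable_funX; exact: measurable_funB.
have S0 l (z : T * T) : 0 <= ((Y l z.1 - Y l z.2) ^+ 2)%:E by rewrite lee_fin sqr_ge0.
have SE : \sum_(l < L) \int[pi]_z ((Y l z.1 - Y l z.2) ^+ 2)%:E <= D%:E.
  rewrite -ge0_integral_sum//; apply: le_trans distortion.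
  by under eq_integral do rewrite sumEFin.
have fin l : \int[pi]_z ((Y l z.1 - Y l z.2) ^+ 2)%:E \is a fin_num.
  rewrite ge0_fin_numE; last exact: integral_ge0.
  apply: le_lt_trans (ltry D); apply: le_trans SE.
  rewrite (bigD1 l)//= leeDl// sume_ge0// => i _; exact: integral_ge0.
exists (fun l => fine (\int[pi]_z ((Y l z.1 - Y l z.2) ^+ 2)%:E)); split.
  by move=> l; rewrite fineK.
rewrite -lee_fin -sumEFin; apply: le_trans SE.
by apply: lee_sum => l _; rewrite fineK.
Qed.

Let EXh : exists m : 'I_L -> R, forall l, \int[pi]_z (Y l z.2 ^+ 2)%:E = (m l)%:E.
Proof.
have [de [deE _]] := Ediff.
suff fin l : \int[pi]_z (Y l z.2 ^+ 2)%:E \is a fin_num.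
  by exists (fun l => fine (\int[pi]_z (Y l z.2 ^+ 2)%:E)) => l; rewrite fineK.
have i1 : pi.-integrable setT (EFin \o (fun z : T * T => (Y l z.1 ^+ 2)%R)).
  by apply: ge0_integrable_fin (EX l); [exact: measurable_funX|move=> x; exact: sqr_ge0].
have i2 : pi.-integrable setT (EFin \o (fun z : T * T => ((Y l z.1 - Y l z.2) ^+ 2)%R)).
  apply: ge0_integrable_fin (deE l); last by move=> x; exact: sqr_ge0.
  by apply: measurable_funX; exact: measurable_funB.
(* The dominating function is [2 Y^2 + 2 (Y - Yh)^2], which exceeds [Yh^2] by [(2 Y - Yh)^2]. *)
have [i3 _] := integral_lincomb3 2 2 0 i1 i2 i2 (EX l) (deE l) (deE l).
apply: integrable_fin_num => //.
apply: (le_integrable measurableT) i3.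
  by apply/measurable_EFinP; exact: measurable_funX.
move=> z _ /=; rewrite lee_fin ger0_norm ?sqr_ge0// mul0r addr0 ger0_norm.
  by have := sqr_ge0 (2 * Y l z.1 - Y l z.2); nra.
by rewrite addr_ge0// mulr_ge0// sqr_ge0.
Qed.

(* [lamh] and [gam] are the energies of the reconstruction and of the linear
   prediction error of the source from it, coordinate by coordinate. *)
Lemma converse_bound : exists lamh gam, feasible lam D P lamh gam /\
  (objective lam gam)%:E <= mutual_info pi.
Proof.
have [de [deE deD]] := Ediff; have [m mE] := EXh.
have i1 l : pi.-integrable setT (EFin \o (fun z : T * T => (Y l z.1 ^+ 2)%R)).
  by apply: ge0_integrable_fin (EX l); [exact: measurable_funX|move=> x; exact: sqr_ge0].
have i2 l : pi.-integrable setT (EFin \o (fun z : T * T => ((Y l z.1 - Y l z.2) ^+ 2)%R)).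
  apply: ge0_integrable_fin (deE l); last by move=> x; exact: sqr_ge0.
  by apply: measurable_funX; exact: measurable_funB.
have i3 l : pi.-integrable setT (EFin \o (fun z : T * T => (Y l z.2 ^+ 2)%R)).
  by apply: ge0_integrable_fin (mE l); [exact: measurable_funX|move=> x; exact: sqr_ge0].
(* By polarisation, [c l] is the cross moment of [Y l] and [Yh l]. *)
pose c l : R := ((lam l + m l - de l) / 2)%R.
have Ea (a : R) l : \int[pi]_z ((Y l z.1 - a * Y l z.2) ^+ 2)%:E =
    (lam l - 2 * a * c l + a ^+ 2 * m l)%:E.
  (* This uses [(Y - a Yh)^2 = (1 - a) Y^2 + a (Y - Yh)^2 + (a^2 - a) Yh^2], so products need not be
     integrated. *)
  have [_ H] := integral_lincomb3 (1 - a) a (a ^+ 2 - a) (i1 l) (i2 l) (i3 l)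
    (EX l) (deE l) (mE l).
  rewrite [RHS](_ : _ = ((1 - a) * lam l + a * de l + (a ^+ 2 - a) * m l)%:E); last first.
    by congr EFin; rewrite /c; field.
  by rewrite -H; apply: eq_integral => z _; congr EFin; ring.
have Ea0 (a : R) l : (0 <= lam l - 2 * a * c l + a ^+ 2 * m l)%R.
  by rewrite -lee_fin -Ea; apply: integral_ge0 => z _; rewrite lee_fin sqr_ge0.
have m0 l : (0 <= m l)%R.
  by rewrite -lee_fin -mE; apply: integral_ge0 => z _; rewrite lee_fin sqr_ge0.
have [nu nuE] := probability_pushforward pi (@measurable_snd _ _ T T).
have m2E : marg2 pi = nu by exact: esym nuE.
have perc (v : 'I_L -> R) : (forall l, 0 < v l)%R ->
    (\sum_(l < L) (ln (lam l / v l) - m l / v l + m l / lam l) / 2 <= P)%R.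
  move=> v0.
  have nuI l : \int[nu]_x (Y l x ^+ 2)%:E = (m l)%:E.
    rewrite nuE -mE ge0_integral_pushforward//.
    - by apply/measurable_EFinP; exact: measurable_funX.
    - by move=> x _; rewrite lee_fin sqr_ge0.
  have nuI0 l : \int[nu]_x ((Y l x - (fun=> 0%R : R) x) ^+ 2)%:E = (m l)%:E.
    by rewrite -nuI; apply: eq_integral => x _; rewrite subr0.
  have [it tE] := @integral_sum_log_ratio _ _ _ nu L Y (fun l => fun=> 0%R) lam v m m mY
    (fun l => measurable_cst _) nuI0 nuI.
  rewrite -lee_fin -tE; apply: le_trans perception.
  rewrite m2E; apply: donsker_varadhan => //.
  by rewrite (integral_expR_log_ratio lam0 indep (fun=> 0%R) v0).
have rate (a g : 'I_L -> R) : (forall l, 0 < g l)%R ->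
    (\sum_(l < L) (ln (lam l / g l) -
      (lam l - 2 * a l * c l + a l ^+ 2 * m l) / g l + 1) / 2)%:E <= mutual_info pi.
  move=> g0.
  have mb l : measurable_fun setT (fun z : T * T => (a l * Y l z.2)%R) by exact: measurable_funM.
  have [it tE] := @integral_sum_log_ratio _ _ _ pi L (fun l z => Y l z.1)
    (fun l z => a l * Y l z.2)%R lam g _ lam mX mb (fun l => Ea (a l) l) EX.
  rewrite [leLHS](_ : _ = \int[pi]_z (\sum_(l < L)
    log_ratio (lam l) (a l * Y l z.2) (g l) (Y l z.1))%:E); last first.
    by rewrite tE; congr EFin; apply: eq_bigr => l _; rewrite (divff (lt0r_neq0 (lam0 l))).
  rewrite /mutual_info marg1E m2E.
  apply: (@donsker_varadhan _ _ _ pi (mu \x nu)%E) => //.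
  have mt : measurable_fun setT (fun z : T * T => (expR (\sum_(l < L)
      log_ratio (lam l) (a l * Y l z.2) (g l) (Y l z.1)))%:E).
    apply/measurable_EFinP; apply: measurableT_comp => //.
    by apply/measurable_EFinP; exact: measurable_int it.
  (* For a fixed second argument [y] the test function is a log ratio with means [a l * Y l y], so
     the inner integral is 1. *)
  rewrite (fubini_tonelli2 _ mt) => [|z]; last by rewrite lee_fin expR_ge0.
  rewrite (eq_integral (cst 1)) => [|y _]; last first.
    exact: (integral_expR_log_ratio lam0 indep (fun l => a l * Y l y)%R g0).
  by rewrite (integral_cst nu measurableT) [X in _ * X]probability_setT mule1.
have others l (k : R) (h : 'I_L -> R) :
  (forall i, i != l -> h i = 0%R) -> h l = k -> (\sum_(i < L) h i = k)%R.
  by move=> h0 hl; rewrite (bigD1 l)//= hl big1 ?addr0.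
have mpos l : (0 < m l)%R.
  rewrite lt0r m0 andbT; apply/eqP => ml0.
  (* If [m l] were [0], this variance would make the left side of [perc] equal to [|P| + 1]; the
     other coordinates contribute [0]. *)
  pose v i := if i == l then (lam l * expR (- (2 * (`|P| + 1))))%R else lam i.
  have v0 i : (0 < v i)%R by rewrite /v; case: ifP => // _; rewrite mulr_gt0 ?expR_gt0.
  have := perc v v0; rewrite (others l (`|P| + 1)%R).
  - by have := ler_norm P; lra.
  - move=> i il; rewrite /v (negbTE il) divff ?gt_eqF// ln1 add0r addNr mul0r//.
  - rewrite /v eqxx ml0 !mul0r subr0 addr0 invfM mulrA divff ?gt_eqF// mul1r -expRN expRK.
    by rewrite opprK; field.
have ratefin : exists I : R, mutual_info pi = I%:E.
  have := rate (fun=> 0%R) lam lam0; move: rate_fin.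
  by case: (mutual_info pi) => // I _ _; exists I.
have [I IE] := ratefin.
(* The regression coefficient of [Y l] on [Yh l]; it minimises the quadratic in [Ea], and [gam l] is
   the minimum. *)
pose a l := (c l / m l)%R.
pose gam l := (lam l - c l ^+ 2 / m l)%R.
have gamE l : (lam l - 2 * a l * c l + a l ^+ 2 * m l = gam l)%R.
  by rewrite /a /gam; field; rewrite gt_eqF.
have gpos l : (0 < gam l)%R.
  rewrite lt0r -{2}gamE Ea0 andbT; apply/eqP => gl0.
  (* With zero prediction error at [l], this variance would make [rate] read
     [|I| + 1 + 1 / 2 <= I]. *)
  pose g i := if i == l then (lam l * expR (- (2 * (`|I| + 1))))%R else lam i.
  pose a' i := if i == l then a l else 0%R.
  have g0 i : (0 < g i)%R by rewrite /g; case: ifP => // _; rewrite mulr_gt0 ?expR_gt0.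
  have := rate a' g g0; rewrite IE lee_fin (others l (`|I| + 1 + 2^-1)%R).
  - by have := ler_norm I; lra.
  - move=> i il; rewrite /g /a' (negbTE il) divff ?gt_eqF// ln1.
    by rewrite mulr0 mul0r subr0 expr0n mul0r addr0 divff ?gt_eqF// add0r addNr mul0r.
  - rewrite /g /a' eqxx gamE gl0 mul0r subr0 invfM mulrA divff ?gt_eqF// mul1r -expRN expRK.
    by rewrite opprK; field.
exists m, gam; split; first split.
- by move=> l; rewrite gpos /= /gam gerBl divr_ge0// sqr_ge0.
- split; first exact: m0.
  split.
    apply: le_trans deD; apply: ler_sum => l _; rewrite /Dl /gam.
    (* The square root in [Dl] is therefore [|c l| >= c l], whence
       [Dl <= lam l - 2 c l + m l = de l]. *)
    rewrite (_ : m l * _ = c l ^+ 2)%R; last by field; rewrite gt_eqF.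
    by rewrite sqrtr_sqr; have := ler_norm (c l); rewrite /c; lra.
  have := perc m mpos; rewrite -lee_fin -sumEFin; apply: le_trans.
  apply: lee_sum => l _; rewrite /Pl gt_eqF// lee_fin (divff (lt0r_neq0 (mpos l))).
  lra.
- have := rate a gam gpos; apply: le_trans; rewrite /objective lee_fin mulr_suml.
  apply: ler_sum => l _; rewrite gamE divff ?gt_eqF//; lra.
Qed.

End converse.

(** * Construction of a law attaining the bound *)

Section build_probability.
Context d (T : measurableType d) (R : realType).
Local Open Scope ereal_scope.

Lemma probability_weight (mu : {measure set T -> \bar R}) (f : T -> R) :
  measurable_fun setT f -> (forall x, 0 <= f x)%R -> \int[mu]_x (f x)%:E = 1 ->
  exists nu : probability T R, is_density nu mu f.
Proof.
move=> mf f0 f1; have [n dn] := measure_weight mu mf f0.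
have [||||nu nuE] := @probability_of_fun _ T R n.
- exact: measure0.
- exact: measure_ge0.
- exact: measure_semi_sigma_additive.
- by have [_ [_ ->]] := dn.
by exists nu; rewrite nuE.
Qed.

(* A probability is a function on all sets, constrained only on measurable
   ones: its values elsewhere can be prescribed. *)
Lemma probability_redefine (P : probability T R) (h : set T -> \bar R) :
  (forall A, 0 <= h A) ->
  exists Q : probability T R, (forall A, measurable A -> Q A = P A) /\
    (forall A, ~ measurable A -> Q A = h A).
Proof.
move=> h0; pose q A := if pselect (measurable A) then P A else h A.
have qm A : measurable A -> q A = P A by rewrite /q; case: pselect.
have qn A : ~ measurable A -> q A = h A by rewrite /q; case: pselect.
have [||||Q QE] := @probability_of_fun _ T R q.
- by rewrite qm ?measure0.
- by move=> A; rewrite /q; case: pselect => ?; [exact: measure_ge0|exact: h0].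
- move=> F mF tF mUF; rewrite qm//.
  under eq_fun do under eq_bigr do rewrite qm//.
  exact: measure_semi_sigma_additive.
- by rewrite qm ?probability_setT.
by exists Q; rewrite QE.
Qed.

End build_probability.

(** Averaging the normal density of mean [a y] and variance [gam] at [x] over [y] gives the centred
    density of variance [lam] at [x], which cancels the denominator of the ratio. *)
Lemma integral_normal_channel {R : realType} (lam gam lamh a x : R) :
  0 < lam -> 0 < gam -> 0 < lamh -> lam = gam + a ^+ 2 * lamh ->
  (\int[normal_prob 0 (Num.sqrt lam)]_y
    (expR (log_ratio lam (a * y) gam x) * expR (log_ratio lam 0 lamh y))%:E = 1)%E.
Proof.
move=> lam0 gam0 lamh0 lamE.
have sq0 (v : R) : 0 < v -> Num.sqrt v != 0 by move=> v0; rewrite gt_eqF// sqrtr_gt0.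
have pl := normal_pdf_gt0 0 x (sq0 _ lam0).
have mr : measurable_fun [set: R] (fun y => (expR (log_ratio lam (a * y) gam x))%:E).
  apply/measurable_EFinP.
  under eq_fun do rewrite -normal_ratioE//.
  by apply: measurable_funM => //; exact: measurable_normal_pdf_mean (sq0 _ gam0).
have r0 y : (0 <= (expR (log_ratio lam (a * y) gam x))%:E)%E by rewrite lee_fin expR_ge0.
transitivity (\int[normal_prob 0 (Num.sqrt lam)]_y
   ((normal_pdf 0 (Num.sqrt lamh) y / normal_pdf 0 (Num.sqrt lam) y)%:E *
    (expR (log_ratio lam (a * y) gam x))%:E))%E.
  by apply: eq_integral => y _; rewrite normal_ratioE// -EFinM mulrC.
apply: (etrans (integral_normal_ratio 0 (sq0 _ lamh0) (sq0 _ lam0) mr r0)).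
apply: (etrans (integral_normal_prob _ _ mr r0)).
transitivity (\int[lebesgue_measure]_y ((normal_pdf 0 (Num.sqrt lam) x)^-1%:E *
   (normal_pdf (a * y) (Num.sqrt gam) x * normal_pdf 0 (Num.sqrt lamh) y)%:E))%E.
  apply: eq_integral => y _; rewrite -normal_ratioE// -!EFinM; congr EFin.
  by rewrite mulrCA mulrA.
rewrite ge0_integralZl; last 4 first.
- by [].
- apply/measurable_EFinP; apply: measurable_funM; last exact: measurable_normal_pdf.
  exact: measurable_normal_pdf_mean (sq0 _ gam0).
- by move=> y _; rewrite lee_fin mulr_ge0// normal_pdf_ge0.
- by rewrite lee_fin invr_ge0 ltW.
rewrite (integral_normal_mixture _ _ (sq0 _ lamh0) (sq0 _ gam0)) !sqr_sqrtr ?ltW// -lamE.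
by rewrite -EFinM mulVf// gt_eqF.
Qed.

Section achievability.
Context d (T : measurableType d) (R : realType) (L : nat).
Local Open Scope ereal_scope.
Variables (mu : probability T R) (Y : 'I_L -> T -> R) (lam : 'I_L -> R).
Hypotheses (mY : forall l, measurable_fun setT (Y l)) (lam0 : forall l, (0 < lam l)%R).
Hypothesis indep : forall (F : 'I_L -> R -> R) (c : 'I_L -> R),
  (forall l, measurable_fun [set: R] (F l)) -> (forall l x, (0 <= F l x)%R) ->
  (forall l, \int[normal_prob 0 (Num.sqrt (lam l))]_x (F l x)%:E = (c l)%:E) ->
  \int[mu]_x (\prod_(l < L) F l (Y l x))%:E = (\prod_(l < L) c l)%:E.

Variables (gam lamh : 'I_L -> R).
Hypotheses (gam0 : forall l, (0 < gam l)%R) (gam_le : forall l, (gam l <= lam l)%R).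
Hypothesis lamh0 : forall l, (0 < lamh l)%R.

(** The gain for which [a Yh + N(0, gam)] has the variance [lam] of the source. *)
Let a l : R := Num.sqrt ((lam l - gam l) / lamh l).

Let a2 l : (a l ^+ 2 * lamh l = lam l - gam l)%R.
Proof.
rewrite sqr_sqrtr ?divfK ?gt_eqF// divr_ge0 ?subr_ge0//; exact: ltW.
Qed.

Let lamE l : (lam l = gam l + a l ^+ 2 * lamh l)%R.
Proof. by rewrite a2 addrC subrK. Qed.

(* Relative to the law [N(0, lam)] of the source, [h] is the density of the
   reconstruction [N(0, lamh)] and [g] that of the backward channel
   [Y = a Yh + N(0, gam)]. *)
Let h (y : T) : R := expR (\sum_(l < L) log_ratio (lam l) 0 (lamh l) (Y l y)).
Let g (z : T * T) : R :=
  expR (\sum_(l < L) log_ratio (lam l) (a l * Y l z.2) (gam l) (Y l z.1)).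

Let h0 y : (0 <= h y)%R. Proof. exact: expR_ge0. Qed.
Let g0 z : (0 <= g z)%R. Proof. exact: expR_ge0. Qed.

Let mX l : measurable_fun setT (fun z : T * T => Y l z.1).
Proof. exact: (@measurableT_comp _ _ _ _ _ _ (Y l) _ fst). Qed.

Let mXh l : measurable_fun setT (fun z : T * T => Y l z.2).
Proof. exact: (@measurableT_comp _ _ _ _ _ _ (Y l) _ snd). Qed.

Let mh : measurable_fun setT h.
Proof.
apply: measurableT_comp => //; apply: measurable_sum => l.
exact: (@measurableT_comp _ _ _ _ _ _ (fun y => log_ratio (lam l) 0 (lamh l) y) _ (Y l)
  (measurable_log_ratio _ _ _)).
Qed.

Let mg : measurable_fun setT g.
Proof.
apply: measurableT_comp => //; apply: measurable_sum => l.
apply: measurable_funM => //; apply: measurable_funD.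
  apply: measurable_funB => //; apply: measurable_funM => //; apply: measurable_funX.
  by apply: measurable_funB => //; exact: measurable_funM.
by apply: measurable_funM => //; exact: measurable_funX.
Qed.

(** Integrating out the reconstruction leaves density 1 for the source, so the first marginal will
    be [mu]. *)
Let channel_mass x : \int[mu]_y (g (x, y) * h y)%:E = 1.
Proof.
pose F l (y : R) := (expR (log_ratio (lam l) (a l * y) (gam l) (Y l x)) *
  expR (log_ratio (lam l) 0 (lamh l) y))%R.
have -> : 1 = (\prod_(l < L) (fun=> 1%R : R) l)%:E :> \bar R by rewrite big1.
rewrite -(@indep F).
- apply: eq_integral => y _; congr EFin.
  by rewrite /g /h /F big_split/= !expR_sum.
- move=> l; apply: measurable_funM; apply: measurableT_comp => //.
    apply: measurable_funM => //; apply: measurable_funD => //.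
    apply: measurable_funB => //; apply: measurable_funM => //; apply: measurable_funX.
    by apply: measurable_funB => //; exact: measurable_funM.
  exact: measurable_log_ratio.
- by move=> l y; rewrite mulr_ge0 ?expR_ge0.
- by move=> l; exact: integral_normal_channel (lamE l).
Qed.

Lemma achievability : exists pi : probability (T * T)%type R,
  [/\ marg1 pi = mu,
    \int[pi]_z (\sum_(l < L) (Y l z.1 - Y l z.2) ^+ 2)%:E =
      (\sum_(l < L) Dl (lam l) (gam l) (lamh l))%:E,
    KL (marg2 pi) mu = \sum_(l < L) Pl (lam l) (lamh l) &
    mutual_info pi = (objective lam gam)%:E].
Proof.
have [nu dnu] := probability_weight mh h0
  (integral_expR_log_ratio lam0 indep (fun=> 0%R) lamh0).
have mgE : measurable_fun setT (EFin \o g) by exact/measurable_EFinP.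
have gE0 z : 0 <= (EFin \o g) z by rewrite lee_fin.
have mgy y : measurable_fun setT (fun x => (EFin \o g) (x, y)).
  exact: (@measurableT_comp _ _ _ _ _ _ (EFin \o g)).
have mgx x : measurable_fun setT (fun y => (EFin \o g) (x, y)).
  exact: (@measurableT_comp _ _ _ _ _ _ (EFin \o g)).
have gx1 y : \int[mu]_x (g (x, y))%:E = 1.
  exact: (integral_expR_log_ratio lam0 indep (fun l => a l * Y l y)%R gam0).
have gy1 x : \int[nu]_y (g (x, y))%:E = 1.
  apply: (etrans (is_density_ge0_integral dnu (mgx x) (fun y => gE0 (x, y)))).
  by rewrite -(channel_mass x); apply: eq_integral => y _; rewrite /= -EFinM.
have [rho drho] : exists rho : probability (T * T)%type R, is_density rho (mu \x nu) g.
  apply: probability_weight => //.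
  rewrite (fubini_tonelli2 _ mgE gE0).
  rewrite (eq_integral (cst 1)) => [|y _]; last exact: gx1.
  by rewrite (integral_cst nu measurableT) [X in _ * X]probability_setT mule1.
have [pi [piE piN]] := probability_redefine rho
  (fun C : set (T * T) => measure_ge0 mu [set x | C (x, point)]).
have dpi : is_density pi (mu \x nu) g.
  split=> //; split=> // A mA; rewrite piE//.
  by have [_ [_ ->]] := drho.
have piI (F : T * T -> \bar R) : measurable_fun setT F -> (forall z, 0 <= F z) ->
    \int[pi]_z F z = \int[nu]_y \int[mu]_x (F (x, y) * (g (x, y))%:E).
  move=> mF F0; rewrite (is_density_ge0_integral dpi mF F0) fubini_tonelli2//.
  - exact: emeasurable_funM.
  - by move=> z; rewrite mule_ge0// lee_fin.
have m1 : marg1 pi = mu.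
  apply/funext => A; rewrite /marg1 /pushforward.
  have [mA|nA] := pselect (measurable A).
    have mfA : measurable (fst @^-1` A : set (T * T)).
      by rewrite -[X in measurable X]setTI; exact: measurable_fst.
    have [_ [_ ->//]] := dpi.
    rewrite integral_mkcond.
    transitivity (\int[mu \x nu]_z ((\1_A z.1)%:E * (g z)%:E)).
      apply: eq_integral => z _; rewrite patchE indicE.
      rewrite (_ : (z \in fst @^-1` A) = (z.1 \in A)); last first.
        by apply/idP/idP; rewrite !inE.
      by case: (_ \in _); rewrite ?mul1e ?mul0e.
    have mi : measurable_fun setT (fun z : T * T => (\1_A z.1)%:E * (g z)%:E).
      apply: emeasurable_funM => //; apply/measurable_EFinP.
      exact: (@measurableT_comp _ _ _ _ _ _ (\1_A : T -> R) _ fst).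
    rewrite (fubini_tonelli1 _ mi) => [|z]; last by rewrite mule_ge0 ?lee_fin.
    rewrite (eq_integral (fun x => (\1_A x)%:E)) => [|x _].
      by rewrite integral_indic ?setIT.
    rewrite /fubini_F /=.
    transitivity ((\1_A x)%:E * \int[nu]_y (g (x, y))%:E); last by rewrite gy1 mule1.
    have i0 : 0 <= (\1_A x : R)%:E by rewrite lee_fin.
    exact: (ge0_integralZl nu measurableT (mgx x) (fun y _ => gE0 (x, y)) i0).
  (* [A] is a section of its cylinder, so a measurable cylinder would make [A] measurable. *)
  rewrite piN//= => mfA; apply: nA.
  rewrite (_ : A = (fun x => (x, point) : T * T) @^-1` (fst @^-1` A)); last by [].
  rewrite -[X in measurable X]setTI.
  by apply: (_ : measurable_fun setT (fun x => (x, point) : T * T)).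
(* The true second marginal is only known to agree with [nu] on measurable sets, so both densities
   are transferred from [nu] to [nu2]. *)
have [nu2 nu2E] := probability_pushforward pi (@measurable_snd _ _ T T).
have m2E : marg2 pi = nu2 by exact: esym nu2E.
have nu12 B : measurable B -> nu2 B = nu B.
  move=> mB; rewrite nu2E /pushforward.
  have mfB : measurable (snd @^-1` B : set (T * T)).
    by rewrite -[X in measurable X]setTI; exact: measurable_snd.
  have mi : measurable_fun setT (fun z : T * T => (\1_B z.2)%:E : \bar R).
    apply/measurable_EFinP.
    exact: (@measurableT_comp _ _ _ _ _ _ (\1_B : T -> R) _ snd).
  transitivity (\int[pi]_z (\1_B z.2)%:E).
    rewrite (_ : (fun z : T * T => (\1_B z.2)%:E) = (fun z => (\1_(snd @^-1` B) z)%:E)).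
      by rewrite integral_indic ?setIT.
    by apply/funext => z; rewrite !indicE; congr (_%:R%:E); apply/idP/idP; rewrite !inE.
  rewrite (piI _ mi) => [|z]; last by rewrite lee_fin.
  rewrite (eq_integral (fun y => (\1_B y)%:E)) => [|y _].
    by rewrite integral_indic ?setIT.
  transitivity ((\1_B y)%:E * \int[mu]_x (g (x, y))%:E); last by rewrite gx1 mule1.
  have i0 : 0 <= (\1_B y : R)%:E by rewrite lee_fin.
  exact: (ge0_integralZl mu measurableT (mgy y) (fun x _ => gE0 (x, y)) i0).
have dnu2 : is_density nu2 mu h.
  split=> //; split=> // B mB; rewrite nu12//.
  by have [_ [_ ->]] := dnu.
have EY l : \int[nu2]_y (Y l y ^+ 2)%:E = (lamh l)%:E.
  have mY2 : measurable_fun setT (fun y => (Y l y ^+ 2)%:E).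
    by apply/measurable_EFinP; exact: measurable_funX.
  rewrite (is_density_ge0_integral dnu2 mY2) => [|y]; last by rewrite lee_fin sqr_ge0.
  rewrite -(@integral_expR_log_ratio_mul _ _ _ _ mu Y lam lam0 indep (fun=> 0%R) lamh l
    (fun y => y ^+ 2)%R (lamh l) lamh0).
  - by apply: eq_integral => y _; rewrite -EFinM mulrC.
  - exact: measurable_funX.
  - by move=> y; exact: sqr_ge0.
  - by rewrite integral_normal_sqr ?sqr_sqrtr ?ltW// gt_eqF// sqrtr_gt0.
have EY' l : \int[nu2]_y ((Y l y - (fun=> 0%R : R) y) ^+ 2)%:E = (lamh l)%:E.
  by rewrite -EY; apply: eq_integral => y _; rewrite subr0.
have dpi2 : is_density pi (mu \x nu2) g.
  split=> //; split=> // A mA; have [_ [_ ->//]] := dpi.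
  apply: eq_measure_integral => C mC _; rewrite /product_measure1.
  by apply: eq_integral => x _ /=; rewrite nu12//; exact: measurable_xsection.
(* Three values of [e] are used: [1] for the distortion, [a l] for the channel noise and [0] for the
   source energy. *)
have Epi (e : R) l : \int[pi]_z ((Y l z.1 - e * Y l z.2) ^+ 2)%:E =
    (gam l + (a l - e) ^+ 2 * lamh l)%:E.
  have me : measurable_fun setT (fun z : T * T => ((Y l z.1 - e * Y l z.2) ^+ 2)%:E).
    apply/measurable_EFinP; apply: measurable_funX; apply: measurable_funB => //.
    exact: measurable_funM.
  rewrite (piI _ me) => [|z]; last by rewrite lee_fin sqr_ge0.
  transitivity (\int[nu]_y (gam l + (a l - e) ^+ 2 * Y l y ^+ 2)%:E).
    apply: eq_integral => y _ /=.
    rewrite -(@integral_expR_log_ratio_mul _ _ _ _ mu Y lam lam0 indep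
      (fun l => a l * Y l y)%R gam l (fun x => (x - e * Y l y) ^+ 2)%R _ gam0).
    - by apply: eq_integral => x _; rewrite -EFinM mulrC.
    - by apply: measurable_funX; exact: measurable_funB.
    - by move=> x; exact: sqr_ge0.
    - rewrite integral_normal_sqr_sub ?sqr_sqrtr ?ltW ?gt_eqF ?sqrtr_gt0//.
      by congr EFin; ring.
  transitivity (\int[nu2]_y (gam l + (a l - e) ^+ 2 * Y l y ^+ 2)%:E).
    by apply: eq_measure_integral => A mA _; exact/esym/nu12.
  have i1 : nu2.-integrable setT (EFin \o (fun y => Y l y ^+ 2)%R).
    by apply: ge0_integrable_fin (EY l); [exact: measurable_funX|move=> y; exact: sqr_ge0].
  have hC : \int[nu2]_x ((cst 1%R : T -> R) x)%:E = 1%:E.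
    apply: (etrans (integral_cst nu2 measurableT 1)).
    by rewrite [X in _ * X]probability_setT mule1.
  have i3 : nu2.-integrable setT (EFin \o cst 1%R).
    by apply: ge0_integrable_fin hC; [exact: measurable_cst|move=> x; exact: ler01].
  have [_ H] := integral_lincomb3 (gam l) ((a l - e) ^+ 2) 0 i3 i1 i1 hC (EY l) (EY l).
  rewrite [RHS](_ : _ = (gam l * 1 + (a l - e) ^+ 2 * lamh l + 0 * lamh l)%:E); last first.
    by rewrite mulr1 mul0r addr0.
  by rewrite -H; apply: eq_integral => y _; rewrite /= mulr1 mul0r addr0.
exists pi; split => //.
- have mS l : measurable_fun setT (fun z : T * T => ((Y l z.1 - Y l z.2) ^+ 2)%:E).
    by apply/measurable_EFinP; apply: measurable_funX; exact: measurable_funB.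
  transitivity (\int[pi]_z \sum_(l < L) ((Y l z.1 - Y l z.2) ^+ 2)%:E).
    by apply: eq_integral => z _; rewrite sumEFin.
  rewrite ge0_integral_sum//; last by move=> l z _; rewrite lee_fin sqr_ge0.
  rewrite -sumEFin; apply: eq_bigr => l _.
  transitivity (\int[pi]_z ((Y l z.1 - 1 * Y l z.2) ^+ 2)%:E).
    by apply: eq_integral => z _; rewrite mul1r.
  rewrite Epi /Dl (_ : lamh l * (lam l - gam l) = (a l * lamh l) ^+ 2)%R; last first.
    by rewrite -a2; ring.
  rewrite sqrtr_sqr ger0_norm ?mulr_ge0 ?sqrtr_ge0 ?ltW//.
  by congr EFin; rewrite [in RHS]lamE; ring.
- have [iI EI] := @integral_sum_log_ratio _ _ _ nu2 L Y (fun l => fun=> 0%R) lam lamh lamh lamh mY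
    (fun l => measurable_cst _) EY' EY.
  rewrite m2E (KL_integral_ln dnu2); last first.
    by apply: (eq_integrable measurableT) iI => y _; rewrite /h /= expRK.
  transitivity (\int[nu2]_y (\sum_(l < L) log_ratio (lam l) 0 (lamh l) (Y l y))%:E).
    by apply: eq_integral => y _; rewrite /h expRK.
  rewrite EI -sumEFin; apply: eq_bigr => l _; rewrite /Pl gt_eqF//; congr EFin.
  by rewrite (divff (lt0r_neq0 (lamh0 l))); lra.
- have mb l : measurable_fun setT (fun z : T * T => (a l * Y l z.2)%R) by exact: measurable_funM.
  have E1 l : \int[pi]_z ((Y l z.1 - a l * Y l z.2) ^+ 2)%:E = (gam l)%:E.
    by rewrite Epi subrr expr0n mul0r addr0.
  have E2 l : \int[pi]_z (Y l z.1 ^+ 2)%:E = (lam l)%:E.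
    transitivity (\int[pi]_z ((Y l z.1 - 0 * Y l z.2) ^+ 2)%:E).
      by apply: eq_integral => z _; rewrite mul0r subr0.
    by rewrite Epi subr0 -lamE.
  have [iI EI] := @integral_sum_log_ratio _ _ _ pi L (fun l z => Y l z.1)
    (fun l z => a l * Y l z.2)%R lam gam gam lam mX mb E1 E2.
  rewrite /mutual_info m1 m2E (KL_integral_ln dpi2); last first.
    by apply: (eq_integrable measurableT) iI => z _; rewrite /g /= expRK.
  transitivity (\int[pi]_z
      (\sum_(l < L) log_ratio (lam l) (a l * Y l z.2) (gam l) (Y l z.1))%:E).
    by apply: eq_integral => z _; rewrite /g expRK.
  rewrite EI /objective mulr_suml; congr EFin; apply: eq_bigr => l _.
  by rewrite (divff (lt0r_neq0 (lam0 l))) (divff (lt0r_neq0 (gam0 l))) subrK.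
Qed.

End achievability.

(** * Existence of a minimizer *)

Section minimizer.
Context {R : realType} (L : nat) (lam : 'I_L -> R) (D P : R).
Hypothesis lam0 : forall l, 0 < lam l.
Implicit Types (lamh gam : 'I_L -> R).

Lemma feasible_gt0 lamh gam : feasible lam D P lamh gam -> forall l, 0 < lamh l.
Proof.
move=> [_ [lh0 [_ lP]]] l; rewrite lt0r lh0 andbT; apply/eqP => lh.
suff E : (\sum_(l < L) Pl (lam l) (lamh l) = +oo)%E by move: lP; rewrite E.
apply/esum_eqyP; first by move=> i _; rewrite /Pl; case: ifP.
by exists l; rewrite mem_index_enum /Pl lh eqxx.
Qed.

Let Plr l (x : R) : R := (x / lam l - 1 + (ln (lam l) - ln x)) / 2.

Let sum_Pl lamh : (forall l, 0 < lamh l) ->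
  (\sum_(l < L) Pl (lam l) (lamh l) = (\sum_(l < L) Plr l (lamh l))%:E)%E.
Proof.
move=> lh0; rewrite -sumEFin; apply: eq_bigr => l _.
by rewrite /Pl gt_eqF// ln_div ?posrE.
Qed.

Let Plr_ge0 l x : 0 < x -> 0 <= Plr l x.
Proof.
move=> x0; have := @le_ln1Dx R (x / lam l - 1).
rewrite (_ : 1 + (x / lam l - 1) = x / lam l); last by ring.
have r0 : 0 < x / lam l by rewrite divr_gt0.
rewrite (_ : -1 < x / lam l - 1); last by lra.
by move=> /(_ isT); rewrite ln_div ?posrE// /Plr; lra.
Qed.

(** Bounds for [Plr l x <= P], with [r = x / lam l]: [r > 0] gives [ln r >= - (2 P + 1)], while
    [ln r <= ln 2 + r / 2 - 1] gives [r <= 2 (2 P + ln 2)]. *)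
Let lo l : R := lam l * expR (- (2 * P + 1)).
Let hi l : R := lam l * (2 * (2 * P + ln 2)).
Let lo0 l : 0 < lo l. Proof. by rewrite mulr_gt0 ?expR_gt0. Qed.

Let Plr_bounds l x : 0 < x -> Plr l x <= P -> lo l <= x <= hi l.
Proof.
move=> x0 xP.
have r0 : 0 < x / lam l by rewrite divr_gt0.
have xE : x = lam l * (x / lam l) by rewrite mulrC divfK// gt_eqF.
have lnr : ln (x / lam l) = ln x - ln (lam l) by rewrite ln_div ?posrE.
rewrite [in X in _ <= X <= _]xE /lo /hi !ler_pM2l//; apply/andP; split.
  rewrite -[leRHS]lnK ?posrE// ler_expR lnr.
  by move: xP; rewrite /Plr; lra.
have := @le_ln1Dx R (x / lam l / 2 - 1).
rewrite (_ : 1 + (x / lam l / 2 - 1) = x / lam l / 2); last by ring.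
rewrite (_ : -1 < x / lam l / 2 - 1); last by lra.
move=> /(_ isT); rewrite ln_div ?posrE// lnr.
by move: xP; rewrite /Plr; lra.
Qed.

Let ln_ratio_ge0 gam l : 0 < gam l <= lam l -> 0 <= ln (lam l / gam l).
Proof.
by move=> /andP[g0 gl]; rewrite ln_ge0// ler_pdivlMr// mul1r.
Qed.

Let cvg_bigsum (V : topologicalType) (F : 'I_L -> V -> R) (v : V) :
  (forall l, F l w @[w --> v] --> F l v) ->
  (\sum_(l < L) F l w) @[w --> v] --> \sum_(l < L) F l v.
Proof.
move=> cF; elim: (index_enum _) => [|l s ih].
  under eq_fun do rewrite big_nil.
  by rewrite big_nil; exact: cvg_cst.
under eq_fun do rewrite big_cons.
by rewrite big_cons; apply: cvgD.
Qed.

Let cvg_ln_max (V : topologicalType) (f : V -> R) (v : V) (c : R) : 0 < c ->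
  f w @[w --> v] --> f v -> ln (Num.max c (f w)) @[w --> v] --> ln (Num.max c (f v)).
Proof.
move=> c0 cf; apply: (cvg_comp (fun w => Num.max c (f w)) (@ln R)); last first.
  by apply: continuous_ln; rewrite lt_max c0.
exact: (@continuous_max _ _ (cst c) f v (cvg_cst _) cf).
Qed.

Let cvg_Dl (V : topologicalType) (g h : V -> R) (v : V) (c : R) :
  g w @[w --> v] --> g v -> h w @[w --> v] --> h v ->
  Dl c (g w) (h w) @[w --> v] --> Dl c (g v) (h v).
Proof.
move=> cg ch; apply: cvgD => //; apply: cvgB; first exact: cvg_cst.
apply: cvgM; first exact: cvg_cst.
apply: (cvg_comp (fun w => h w * (c - g w)) (@Num.sqrt R)); last first.
  exact: sqrt_continuous.
by apply: cvgM => //; apply: cvgB => //; exact: cvg_cst.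
Qed.

Let cvg_Plr_max (V : topologicalType) (h : V -> R) (v : V) l :
  h w @[w --> v] --> h v ->
  ((h w / lam l - 1 + (ln (lam l) - ln (Num.max (lo l) (h w)))) / 2) @[w --> v] -->
  (h v / lam l - 1 + (ln (lam l) - ln (Num.max (lo l) (h v)))) / 2.
Proof.
move=> ch; apply: cvgM; last exact: cvg_cst.
apply: cvgD; last by apply: cvgB; [exact: cvg_cst|exact: cvg_ln_max].
by apply: cvgB; [apply: cvgM => //|]; exact: cvg_cst.
Qed.

Let cvg_sum_ln (V : topologicalType) (g : 'I_L -> V -> R) (v : V) (c : 'I_L -> R) :
  (forall l, 0 < c l) -> (forall l, g l w @[w --> v] --> g l v) ->
  ((\sum_(l < L) (ln (lam l) - ln (Num.max (c l) (g l w)))) / 2) @[w --> v] -->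
  (\sum_(l < L) (ln (lam l) - ln (Num.max (c l) (g l v)))) / 2.
Proof.
move=> c0 cg; apply: cvgM; last exact: cvg_cst.
apply: (cvg_bigsum (F := fun l w => ln (lam l) - ln (Num.max (c l) (g l w)))) => l.
by apply: cvgB; [exact: cvg_cst|exact: cvg_ln_max].
Qed.

Lemma objective_minimizer : (exists lamh gam, feasible lam D P lamh gam) ->
  exists lamh gam, feasible lam D P lamh gam /\
    forall lamh' gam', feasible lam D P lamh' gam' ->
      objective lam gam <= objective lam gam'.
Proof.
move=> [lh1 [g1 f1]].
pose O1 := objective lam g1.
(* The condition [0 < gam] is not closed. Every term of the objective is nonnegative, so an
   objective of at most [O1] forces [ln (lam l / gam l) <= 2 O1], that is [gam l >= glo l]. *)
pose glo l : R := lam l * expR (- (2 * O1)).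
have glo0 l : 0 < glo l by rewrite mulr_gt0 ?expR_gt0.
pose G (v : 'rV[R]_(L + L)) l := v ord0 (lshift L l).
pose H (v : 'rV[R]_(L + L)) l := v ord0 (rshift L l).
pose box (i : 'I_(L + L)) : set R := match fintype.split i with
  | inl l => `[glo l, lam l]%classic | inr l => `[lo l, hi l]%classic end.
pose fD (v : 'rV[R]_(L + L)) := \sum_(l < L) Dl (lam l) (G v l) (H v l).
(* Clamping the arguments of [ln] makes [fP] and [fO] continuous everywhere
   without changing them on the box. *)
pose fP (v : 'rV[R]_(L + L)) := \sum_(l < L)
  (H v l / lam l - 1 + (ln (lam l) - ln (Num.max (lo l) (H v l)))) / 2.
pose fO (v : 'rV[R]_(L + L)) := (\sum_(l < L) (ln (lam l) - ln (Num.max (glo l) (G v l)))) / 2.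
have cG v l : G w l @[w --> v] --> G v l by exact: coord_continuous.
have cH v l : H w l @[w --> v] --> H v l by exact: coord_continuous.
have cD : continuous fD.
  move=> v; apply: (cvg_bigsum (F := fun l w => Dl (lam l) (G w l) (H w l))) => l.
  exact: cvg_Dl.
have cP : continuous fP.
  by move=> v; apply: (cvg_bigsum (F := fun l w => (H w l / lam l - 1 +
    (ln (lam l) - ln (Num.max (lo l) (H w l)))) / 2)) => l; exact: cvg_Plr_max.
have cO : continuous fO by move=> v; exact: (cvg_sum_ln (g := fun l w => G w l)).
pose K : set 'rV[R]_(L + L) := [set v : 'rV[R]_(L + L) | forall i, box i (v ord0 i)] `&`
  ([set v | fD v <= D] `&` [set v | fP v <= P]).
have cK : compact K.
  apply: compact_closedI.
    apply: rV_compact => i; rewrite /box.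
    by case: (fintype.split i) => l; exact: segment_compact.
  apply: closedI.
    by apply: (@preimage_closed _ _ fD [set x | x <= D]) => [v _|]; [exact: cD|exact: closed_le].
  by apply: (@preimage_closed _ _ fP [set x | x <= P]) => [v _|]; [exact: cP|exact: closed_le].
have boxE (v : 'rV[R]_(L + L)) : (forall i, box i (v ord0 i)) <->
    forall l, (glo l <= G v l <= lam l) /\ (lo l <= H v l <= hi l).
  split=> [bv l|bv i].
    have := bv (lshift L l); have := bv (rshift L l); rewrite /box.
    by rewrite (unsplitK (inl l)) (unsplitK (inr l)) /= !in_itv.
  rewrite /box -[i in v ord0 i]splitK; case: (fintype.split i) => l /=.
    by rewrite in_itv; exact: (bv l).1.
  by rewrite in_itv; exact: (bv l).2.
have fOE v : (forall l, glo l <= G v l) -> fO v = objective lam (G v).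
  move=> gv; rewrite /fO /objective; congr (_ / _); apply: eq_bigr => l _.
  rewrite (max_idPr (gv l)) ln_div ?posrE//.
  exact: lt_le_trans (gv l).
have inK lamh gam : feasible lam D P lamh gam -> objective lam gam <= O1 ->
    exists v, [/\ K v, forall l, G v l = gam l & forall l, H v l = lamh l].
  move=> f gO; have lh0 := feasible_gt0 f; have [g01 [_ [dD pP]]] := f.
  pose v : 'rV[R]_(L + L) := row_mx (\row_l gam l) (\row_l lamh l).
  have vG l : G v l = gam l by rewrite /G /v row_mxEl mxE.
  have vH l : H v l = lamh l by rewrite /H /v row_mxEr mxE.
  rewrite sum_Pl// lee_fin in pP.
  have bH l : lo l <= lamh l <= hi l.
    apply: Plr_bounds => //; apply: le_trans pP.
    rewrite (bigD1 l)//= lerDl sumr_ge0// => i _; exact: Plr_ge0.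
  have bG l : glo l <= gam l <= lam l.
    have /andP[g0 ->] := g01 l; rewrite andbT.
    have : ln (lam l / gam l) <= 2 * O1.
      rewrite [leRHS]mulrC -ler_pdivrMr//; apply: le_trans gO.
      rewrite /objective ler_pM2r// (bigD1 l)//= lerDl sumr_ge0// => i _.
      exact: ln_ratio_ge0.
    rewrite ln_div ?posrE// => lnO.
    rewrite /glo -[leRHS]lnK ?posrE// -{1}(lnK (lam0 l : lam l \is Num.pos)) -expRD ler_expR.
    lra.
  exists v; split => //; split; first by apply/boxE => l; rewrite vG vH.
  split => /=.
    by rewrite /fD; under eq_bigr do rewrite vG vH.
  rewrite /fP; apply: le_trans pP; apply: ler_sum => l _; rewrite vH.
  by have /andP[? _] := bH l; rewrite max_r.
have [v1 [K1 _ _]] := inK _ _ f1 (lexx _).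
have [v Kv vmin] := @compact_EVT_min _ R fO K (ex_intro _ v1 K1) cK
  (continuous_subspaceT cO).
have [bv [Dv Pv]] : K v by rewrite inE in Kv.
move/boxE : (bv) => bv'.
have gv l : glo l <= G v l by have [/andP[]] := bv' l.
have hv l : lo l <= H v l by have [_ /andP[]] := bv' l.
have fv : feasible lam D P (H v) (G v).
  split.
    by move=> l; have [/andP[? ->] _] := bv' l; rewrite andbT; exact: lt_le_trans (gv l).
  split; first by move=> l; apply: ltW; exact: lt_le_trans (hv l).
  split=> //.
  rewrite sum_Pl => [|l]; last exact: lt_le_trans (hv l).
  rewrite lee_fin; apply: le_trans Pv; apply: ler_sum => l _.
  by rewrite /Plr max_r.
exists (H v), (G v); split => // lamh gam f.
have vO lamh' gam' : feasible lam D P lamh' gam' -> objective lam gam' <= O1 ->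
    objective lam (G v) <= objective lam gam'.
  move=> f' gO; have [w [Kw wG _]] := inK _ _ f' gO.
  have := vmin w (mem_set Kw); rewrite !fOE//.
    by rewrite (_ : G w = gam') //; apply/funext.
  by have [/boxE bw _] := Kw => l; have [/andP[]] := bw l.
(* A competitor above [O1] already loses to the initial feasible point. *)
have [gO|/ltW gO] := leP (objective lam gam) O1; first exact: vO f gO.
exact: le_trans (vO _ _ f1 (lexx _)) gO.
Qed.

End minimizer.

(** * Diagonalising the covariance *)

Section rotation.
Context {R : realType} (L : nat) (Theta : 'M[R]_L).
Hypothesis Theta_orth : Theta^T *m Theta = 1%:M.

Let rot (l : 'I_L) (x : L.-tuple R) : R := dotv (fun j => Theta l j) x.

Lemma measurable_dotv (a : 'I_L -> R) : measurable_fun setT (dotv a).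
Proof.
apply: measurable_sum => i; apply: measurable_funM => //.
exact: measurable_tnth.
Qed.

Lemma sqnorm_rotation (x y : L.-tuple R) :
  sqnorm [tuple tnth x i - tnth y i | i < L] = \sum_(l < L) (rot l x - rot l y) ^+ 2.
Proof.
pose dv : 'rV[R]_L := \row_i (tnth x i - tnth y i).
have -> : sqnorm [tuple tnth x i - tnth y i | i < L] = (dv *m dv^T) ord0 ord0.
  by rewrite mxE; apply: eq_bigr => i _; rewrite tnth_mktuple !mxE expr2.
have -> : dv *m dv^T = (dv *m Theta^T) *m (dv *m Theta^T)^T.
  by rewrite trmx_mul trmxK mulmxA -(mulmxA dv) Theta_orth mulmx1.
rewrite mxE.
apply: eq_bigr => l _; rewrite [X in _ * X]mxE -expr2; congr (_ ^+ 2).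
rewrite mxE /rot /dotv -sumrB; apply: eq_bigr => i _.
by rewrite !mxE mulrBl mulrC [tnth y i * _]mulrC.
Qed.

(** A combination [a] of rotated coordinates is the combination [a Theta] of the original ones; it
    is nonzero because [Theta] is invertible, and the quadratic form of the covariance becomes
    diagonal. *)
Lemma rotation_law (lam : 'I_L -> R) (mu : probability (L.-tuple R) R)
    (a : 'I_L -> R) (F : R -> \bar R) :
  gaussian_law (Theta^T *m diag_mx (\row_l lam l) *m Theta) mu ->
  (exists l, a l != 0) -> measurable_fun [set: R] F -> (forall x, 0 <= F x)%E ->
  (\int[mu]_x F (\sum_(l < L) a l * rot l x)%R =
   \int[normal_prob 0 (Num.sqrt (\sum_(l < L) a l ^+ 2 * lam l))]_z F z)%E.
Proof.
move=> gl [l0 al0] mF F0.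
pose av : 'rV[R]_L := \row_l a l.
pose b j : R := (av *m Theta) ord0 j.
have TT : Theta *m Theta^T = 1%:M by exact: mulmx1C.
have bE x : \sum_(l < L) a l * rot l x = dotv b x.
  rewrite /rot /dotv; under eq_bigr do rewrite mulr_sumr.
  rewrite exchange_big/=; apply: eq_bigr => j _; rewrite /b mxE mulr_suml.
  by apply: eq_bigr => l _; rewrite mxE mulrA.
have b0 : exists j, b j != 0.
  apply/not_existsP => bn; move: al0; apply/negP; rewrite negbK.
  have : av *m Theta = 0.
    by apply/rowP => j; have /negP := bn j; rewrite negbK => /eqP bj; rewrite [RHS]mxE -bj.
  move=> /(congr1 (fun v => v *m Theta^T)); rewrite -mulmxA TT mulmx1 mul0mx.
  by move=> /rowP /(_ l0); rewrite !mxE => /eqP.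
have qE : \sum_(i < L) \sum_(j < L) b i *
    (Theta^T *m diag_mx (\row_l lam l) *m Theta) i j * b j = \sum_(l < L) a l ^+ 2 * lam l.
  set S := _ *m Theta.
  transitivity ((av *m Theta *m S *m (av *m Theta)^T) ord0 ord0).
    rewrite [RHS]mxE exchange_big/=; apply: eq_bigr => j _.
    by rewrite [X in _ * X]mxE [X in X * _]mxE mulr_suml.
  rewrite trmx_mul /S -!mulmxA (mulmxA Theta) TT mul1mx (mulmxA Theta) TT mul1mx.
  rewrite mulmxA mul_mx_diag mxE; apply: eq_bigr => l _.
  by rewrite !mxE expr2 mulrAC.
transitivity (\int[mu]_x (F \o dotv b) x)%E.
  by apply: eq_integral => x _; rewrite bE.
rewrite -qE -(gl b b0).
apply: esym.
exact: (@ge0_integral_pushforward _ _ _ (measurableTypeR R) R _ (measurable_dotv b) mu setT F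
  measurableT mF (fun y _ => F0 y)).
Qed.

End rotation.

Theorem theorem3 (R : realType) (L : nat) (lam : 'I_L -> R)
  (Theta : 'M[R]_L) (muX : probability (L.-tuple R) R) (D P : R) :
  (forall l, 0 < lam l) ->
  Theta^T *m Theta = 1%:M ->
  gaussian_law (Theta^T *m diag_mx (\row_l lam l) *m Theta) muX ->
  RDP muX D P =
    ereal_inf [set (objective lam gam)%:E |
                 gam in [set gam | exists lamh, feasible lam D P lamh gam]] /\
  ((exists lamh gam, feasible lam D P lamh gam) ->
   exists lamh gam, feasible lam D P lamh gam /\
     RDP muX D P = (objective lam gam)%:E).
Proof.
move=> lam0 orth gl.
pose Y l (x : L.-tuple R) : R := dotv (fun j => Theta l j) x.
have mY l : measurable_fun setT (Y l) by exact: measurable_dotv.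
have indep := @integral_prod_normal _ _ R L muX Y lam mY lam0
  (fun a F => @rotation_law R L Theta orth lam muX a F gl).
have sqE (z : L.-tuple R * L.-tuple R) :
    sqnorm [tuple tnth z.1 i - tnth z.2 i | i < L] = \sum_(l < L) (Y l z.1 - Y l z.2) ^+ 2.
  exact: sqnorm_rotation.
set B := [set _ | _ in _].
have RE : RDP muX D P = ereal_inf B.
  apply/eqP; rewrite eq_le; apply/andP; split; apply: le_ereal_inf_tmp.
  - move=> _ [gam [lamh f] <-].
    (* Feasibility excludes [lamh l = 0], where the gain of the backward channel would be
       undefined. *)
    have lh0 := feasible_gt0 f; have [g01 [_ [dD pP]]] := f.
    have g0 l : 0 < gam l by have /andP[] := g01 l.
    have gle l : gam l <= lam l by have /andP[] := g01 l.
    have [pi [m1 dE kE mE]] := achievability mY lam0 indep g0 gle lh0.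
    rewrite -mE; apply: ereal_inf_lbound; exists pi => //; split => //; split; last by rewrite kE.
    by under eq_integral do rewrite sqE; rewrite dE lee_fin.
  - move=> _ [pi [m1 [dD kP]] <-].
    (* [converse_bound] needs a finite rate; an infinite one satisfies the bound trivially. *)
    have [fin|] := boolP (mutual_info pi < +oo)%E; last first.
      by rewrite -leNgt leye_eq => /eqP ->; exact: leey.
    have dD' : (\int[pi]_z (\sum_(l < L) (Y l z.1 - Y l z.2) ^+ 2)%:E <= D%:E)%E.
      by under eq_integral do rewrite -sqE.
    have [lamh [gam [f le]]] := converse_bound mY lam0 indep m1 dD' kP fin.
    apply: le_trans le; apply: ereal_inf_lbound; exists gam => //.
    by exists lamh.
split; first exact: RE.
move=> /(objective_minimizer lam0)[lamh [gam [f fmin]]].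
exists lamh, gam; split => //; rewrite RE.
apply/eqP; rewrite eq_le; apply/andP; split.
  by apply: ereal_inf_lbound; exists gam => //; exists lamh.
by apply: le_ereal_inf_tmp => _ [gam' [lamh' f'] <-]; rewrite lee_fin; exact: fmin f'.
Qed.
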